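(* Let $K$ be a perfect field with separable closure $\overline{K}$, and let $E/K$ be an elliptic curve such that $\mathrm{Aut}_{\overline{K}}(E)$ is abelian. Then the map $$i\colon H^1\big(\mathrm{G}_{\overline{K}/K},\langle -1\rangle\big)\longrightarrow H^1\big(\mathrm{G}_{\overline{K}/K},\mathrm{Aut}_{\overline{K}}(E)\big)$$ induced by the inclusion $\langle -1\rangle\subset\mathrm{Aut}_{\overline{K}}(E)$ is injective, except in the case when $\mathrm{char}(K)\notin\{2,3\}$, $j(E)=12^3$ and $\mathrm{G}_{\overline{K}/K}$ acts non-trivially on $\mathrm{Aut}_{\overline{K}}(E)$; in that case $i$ is not injective.
   Context: $\mathrm{G}_{\overline{K}/K}$ denotes the absolute Galois group of $K$, $\mathrm{Aut}_{\overline{K}}(E)$ is the group of automorphisms of the elliptic curve $E$ defined over $\overline{K}$ (fixing the origin) with its natural Galois action, and $\langle -1\rangle$ is its subgroup of order $2$ generated by multiplication by $-1$. $H^1$ is (continuous) Galois cohomology. *)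

(* Defs.v *)
From HB Require Import structures.
From mathcomp Require Import all_boot all_order all_algebra separable.
From mathcomp Require Import ring.
From mathcomp Require Import boolp classical_sets topology_structure.
From mathcomp Require Import discrete_topology.
From mathcomp Require Import mpoly.

Set Implicit Arguments.
Unset Strict Implicit.
Unset Printing Implicit Defensive.

Import GRing.Theory.
Local Open Scope ring_scope.
Local Open Scope quotient_scope.

Definition perfect_field (K : fieldType) : Prop :=
  forall p : {poly K}, irreducible_poly p -> separable_poly p.

Definition is_separable_closure (K L : fieldType) (iota : {rmorphism K -> L}) :
    Prop :=
  (forall x : L,
     exists2 p : {poly K}, separable_poly p & root (map_poly iota p) x) /\
  (forall p : {poly L}, separable_poly p -> (1 < size p)%N ->
     exists x : L, root p x).

Record galGroup (K L : fieldType) (iota : {rmorphism K -> L}) := GalGroup {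
  gal_fun :> L -> L;
  gal_inv : L -> L;
  gal_funK : cancel gal_fun gal_inv;
  gal_invK : cancel gal_inv gal_fun;
  gal_additive : zmod_morphism gal_fun;
  gal_multiplicative : monoid_morphism gal_fun;
  gal_fix : forall x : K, gal_fun (iota x) = iota x }.

Section GaloisGroup.
Variables (K L : fieldType) (iota : {rmorphism K -> L}).
Local Notation G := (galGroup iota).

HB.instance Definition _ (s : G) :=
  GRing.isZmodMorphism.Build L L s (gal_additive s).
HB.instance Definition _ (s : G) :=
  GRing.isMonoidMorphism.Build L L s (gal_multiplicative s).

Lemma galP (s t : G) : (forall x, s x = t x) -> s = t.
Proof.
case: s t => [f f' fK f'K fa fm ff] [g g' gK g'K ga gm gf] /= e.
have efg : f = g by apply: funext.
subst g.
have efg' : f' = g'.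
  by apply: funext => x; rewrite -{1}(g'K x) fK.
subst g'.
by congr GalGroup; exact: Prop_irrelevance.
Qed.

Lemma gal_inv_additive (s : G) : zmod_morphism (gal_inv s).
Proof.
by move=> x y; apply: (can_inj (gal_funK s)); rewrite rmorphB /= !gal_invK.
Qed.

Lemma gal_inv_multiplicative (s : G) : monoid_morphism (gal_inv s).
Proof.
split=> [|x y]; apply: (can_inj (gal_funK s)).
  by rewrite rmorph1 gal_invK.
by rewrite rmorphM /= !gal_invK.
Qed.

Lemma gal_inv_fix (s : G) x : gal_inv s (iota x) = iota x.
Proof. by apply: (can_inj (gal_funK s)); rewrite gal_invK gal_fix. Qed.

Definition gal_one : G.
Proof. by exists id id. Defined.

Definition gal_comp (s t : G) : G.
Proof.
exists (s \o t) (gal_inv t \o gal_inv s).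
- by move=> x /=; rewrite !gal_funK.
- by move=> x /=; rewrite !gal_invK.
- by move=> x y /=; rewrite !rmorphB.
- by split=> [|x y] /=; rewrite ?rmorph1 ?rmorphM.
- by move=> x /=; rewrite !gal_fix.
Defined.

Definition gal_opp (s : G) : G :=
  GalGroup (gal_invK s) (gal_funK s) (gal_inv_additive s)
         (gal_inv_multiplicative s) (gal_inv_fix s).

HB.instance Definition _ := gen_eqMixin G.
HB.instance Definition _ := gen_choiceMixin G.

Lemma gal_compA : associative gal_comp.
Proof. by move=> s t u; apply: galP. Qed.
Lemma gal_comp1s : left_id gal_one gal_comp.
Proof. by move=> s; apply: galP. Qed.
Lemma gal_comps1 : right_id gal_one gal_comp.
Proof. by move=> s; apply: galP. Qed.
Lemma gal_compVs : left_inverse gal_one gal_opp gal_comp.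
Proof. by move=> s; apply: galP => x; exact: gal_funK. Qed.
Lemma gal_compsV : right_inverse gal_one gal_opp gal_comp.
Proof. by move=> s; apply: galP => x; exact: gal_invK. Qed.

HB.instance Definition _ := isGroup.Build G
  gal_compA gal_comp1s gal_comps1 gal_compVs gal_compsV.

(* The sets {t | t = s on X}, X a finite subset of L, are the cosets
   s Gal(L / K(X)); they form a basis of the Krull topology. *)
Definition krull_open (U : set G) : Prop :=
  forall s, U s ->
    exists X : seq L, forall t : G, {in X, t =1 s} -> U t.

Lemma krull_openT : krull_open setT.
Proof. by move=> s _; exists [::]. Qed.

Lemma krull_openI : setI_closed krull_open.
Proof.
move=> U V oU oV s [/oU[X XU] /oV[Y YV]]; exists (X ++ Y) => t ts.
split; [apply: XU | apply: YV] => x xX; apply: ts.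
  by rewrite mem_cat xX.
by rewrite mem_cat xX orbT.
Qed.

Lemma krull_open_bigU (I : Type) (f : I -> set G) :
  (forall i, krull_open (f i)) -> krull_open (\bigcup_i f i).
Proof.
by move=> of_ s [i _ /of_[X XU]]; exists X => t /XU ft; exists i.
Qed.

HB.instance Definition _ := isOpenTopological.Build G
  krull_openT krull_openI krull_open_bigU.

End GaloisGroup.

(* Every stabilizer in [curveAut] is open, but H^1 is defined without using
   continuity of the action, so it is not required here. *)
Record galModule (K L : fieldType) (iota : {rmorphism K -> L}) := GalModule {
  gm_group :> groupType;
  gm_act : galGroup iota -> gm_group -> gm_group;
  gm_act1 : forall a, gm_act 1%g a = a;
  gm_actA : forall s t a, gm_act (s * t)%g a = gm_act s (gm_act t a);
  gm_actM : forall s, {morph gm_act s : a b / (a * b)%g} }.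

Record galHom (K L : fieldType) (iota : {rmorphism K -> L})
    (A B : galModule iota) := GalHom {
  gh_fun :> A -> B;
  gh_mul : {morph gh_fun : a b / (a * b)%g};
  gh_act : forall s a, gh_fun (gm_act s a) = gm_act s (gh_fun a) }.

Record cocycle (K L : fieldType) (iota : {rmorphism K -> L})
    (A : galModule iota) := Cocycle {
  coc_fun :> galGroup iota -> A;
  coc_continuous : continuous (coc_fun : galGroup iota -> discrete_topology A);
  coc_eq : forall s t, coc_fun (s * t)%g = (coc_fun s * gm_act s (coc_fun t))%g }.

Section Cohomology.
Variables (K L : fieldType) (iota : {rmorphism K -> L}).
Implicit Types A B : galModule iota.

HB.instance Definition _ A := gen_eqMixin (cocycle A).
HB.instance Definition _ A := gen_choiceMixin (cocycle A).

Lemma gm_act_1 A (s : galGroup iota) : gm_act s (1 : A)%g = 1%g.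
Proof.
by apply: (@mulgI _ (gm_act s 1%g)); rewrite -gm_actM !mulg1.
Qed.

Lemma gm_actV A (s : galGroup iota) (a : A) :
  gm_act s (a^-1)%g = ((gm_act s a)^-1)%g.
Proof.
by apply: (@mulgI _ (gm_act s a)); rewrite -gm_actM !mulgV gm_act_1.
Qed.

Definition cohomologous A (c d : cocycle A) : bool :=
  `[< exists a : A, forall s, d s = (a^-1 * c s * gm_act s a)%g >].

Lemma cohomologous_refl A : reflexive (@cohomologous A).
Proof.
by move=> c; apply/asboolP; exists 1%g => s; rewrite gm_act_1 mulg1 invg1 mul1g.
Qed.

Lemma cohomologous_impl A (c d : cocycle A) :
  cohomologous c d -> cohomologous d c.
Proof.
move=> /asboolP[a ca]; apply/asboolP; exists (a^-1)%g => s.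
by rewrite ca invgK gm_actV !mulgA mulgV mul1g mulgK.
Qed.

Lemma cohomologous_sym A (c d : cocycle A) :
  cohomologous c d = cohomologous d c.
Proof. by apply/idP/idP; exact: cohomologous_impl. Qed.

Lemma cohomologous_trans A : transitive (@cohomologous A).
Proof.
move=> d c e /asboolP[a ca] /asboolP[b db]; apply/asboolP.
by exists (a * b)%g => s; rewrite db ca gm_actM invgM !mulgA.
Qed.

Canonical cohomologous_equiv A := EquivRel (@cohomologous A)
  (@cohomologous_refl A) (@cohomologous_sym A) (@cohomologous_trans A).

Definition H1 A := {eq_quot (cohomologous_equiv A)}.

Definition cocycle_map A B (f : galHom A B) (c : cocycle A) : cocycle B.
Proof.
exists (fun s => f (c s)).
- move=> s; apply: (@continuous_comp _ (discrete_topology A)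
                      (discrete_topology B) c f).
    exact: coc_continuous.
  move=> U; rewrite !nbhs_principalE => /principal_filterP Ufcs.
  exact/principal_filterP.
- by move=> s t; rewrite coc_eq gh_mul gh_act.
Defined.

Definition H1_map A B (f : galHom A B) (x : H1 A) : H1 B :=
  \pi_(H1 B) (cocycle_map f (repr x)).

(* [H1_map] does not depend on the representatives picked by [repr]. *)
Lemma H1_map_pi A B (f : galHom A B) (c : cocycle A) :
  H1_map f (\pi_(H1 A) c) = \pi_(H1 B) (cocycle_map f c).
Proof.
apply/eqmodP => /=.
have : cohomologous (repr (\pi_(H1 A) c)) c by apply/eqmodP; rewrite reprK.
move=> /asboolP[a ca]; apply/asboolP; exists (f a) => s /=.
rewrite ca !gh_mul gh_act; congr (_ * _ * _)%g.
apply: (@mulgI _ (f a)); rewrite -gh_mul !mulgV.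
by apply: (@mulgI _ (f 1%g)); rewrite -gh_mul !mulg1.
Qed.

End Cohomology.

Record weierstrass (F : Type) := Weierstrass {
  wa1 : F; wa2 : F; wa3 : F; wa4 : F; wa6 : F }.

Definition weierstrass_map (F F' : Type) (f : F -> F') (W : weierstrass F) :=
  Weierstrass (f (wa1 W)) (f (wa2 W)) (f (wa3 W)) (f (wa4 W)) (f (wa6 W)).

(* y^2 + a1 xy + a3 y = x^3 + a2 x^2 + a4 x + a6 with its usual invariants
   b2, b4, b6, b8, c4, discriminant and j, valid in every characteristic. *)
Section Invariants.
Variables (F : fieldType) (W : weierstrass F).
Definition wb2 : F := wa1 W ^+ 2 + 4 * wa2 W.
Definition wb4 : F := 2 * wa4 W + wa1 W * wa3 W.
Definition wb6 : F := wa3 W ^+ 2 + 4 * wa6 W.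
Definition wb8 : F := wa1 W ^+ 2 * wa6 W + 4 * wa2 W * wa6 W
  - wa1 W * wa3 W * wa4 W + wa2 W * wa3 W ^+ 2 - wa4 W ^+ 2.
Definition wc4 : F := wb2 ^+ 2 - 24 * wb4.
Definition wdisc : F :=
  - wb2 ^+ 2 * wb8 - 8 * wb4 ^+ 3 - 27 * wb6 ^+ 2 + 9 * wb2 * wb4 * wb6.
Definition jinv : F := wc4 ^+ 3 / wdisc.

Definition on_curve (x y : F) : bool :=
  y ^+ 2 + wa1 W * x * y + wa3 W * y ==
  x ^+ 3 + wa2 W * x ^+ 2 + wa4 W * x + wa6 W.
End Invariants.

Record ellipticCurve (F : fieldType) := EllipticCurve {
  ec_weierstrass :> weierstrass F;
  ec_smooth : wdisc ec_weierstrass != 0 }.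

(* The projective cubic has (0 : 1 : 0) as its only point with Z = 0. *)
Inductive point (F : fieldType) (W : weierstrass F) : Type :=
| Origin
| Affine (x y : F) of on_curve W x y.
Arguments Origin {F W}.

Section Automorphisms.
Variables (F : fieldType) (W : weierstrass F).
Implicit Types (P Q : point W) (phi psi : point W -> point W).

Lemma affine_eq x y x' y' (h : on_curve W x y) (h' : on_curve W x' y') :
  x = x' -> y = y' -> Affine h = Affine h'.
Proof.
by move=> ex ey; subst x' y'; rewrite (bool_irrelevance h h').
Qed.

Definition hcoord P : 'I_3 -> F :=
  match P with
  | Origin => tnth [tuple 0; 1; 0]
  | Affine x y _ => tnth [tuple x; y; 1]
  end.

Definition proj_eq (u v : 'I_3 -> F) : Prop :=
  exists2 c : F, c != 0 & forall i, u i = c * v i.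

(* A morphism of projective curves, in the classical language: around every
   point it is given by forms of the same degree without common zero there.
   Only adequate when F is algebraically closed. *)
Definition regular phi : Prop :=
  forall P, exists d (f : 'I_3 -> {mpoly F[3]}),
    [/\ forall i, f i \is d.-homog,
        exists i, (f i).@[hcoord P] != 0 &
        forall Q, (exists i, (f i).@[hcoord Q] != 0) ->
          proj_eq (fun i => (f i).@[hcoord Q]) (hcoord (phi Q))].

Record curveAut := CurveAut {
  aut_fun :> point W -> point W;
  aut_inv : point W -> point W;
  aut_funK : cancel aut_fun aut_inv;
  aut_invK : cancel aut_inv aut_fun;
  aut_regular : regular aut_fun;
  aut_inv_regular : regular aut_inv;
  aut_origin : aut_fun Origin = Origin }.

Lemma curveAutP (a b : curveAut) : (forall P, a P = b P) -> a = b.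
Proof.
case: a b => [f f' fK f'K fr f'r fo] [g g' gK g'K gr g'r go] /= e.
have efg : f = g by apply: funext.
subst g.
have efg' : f' = g' by apply: funext => x; rewrite -{1}(g'K x) fK.
subst g'.
by congr CurveAut; exact: Prop_irrelevance.
Qed.

Lemma meval_homog d (p : {mpoly F[3]}) (c : F) (v : 'I_3 -> F) :
  p \is d.-homog -> p.@[fun i => c * v i] = c ^+ d * p.@[v].
Proof.
move=> /dhomogP hp; rewrite !mevalE mulr_sumr; apply: eq_big_seq => m /hp /= <-.
rewrite mulrCA; congr (_ * _); rewrite mdegE -prodrXr -big_split /=.
by apply: eq_bigr => i _; rewrite exprMn.
Qed.

Lemma comp_homog d e (p : {mpoly F[3]}) (g : 'I_3 -> {mpoly F[3]}) :
  p \is d.-homog -> (forall i, g i \is e.-homog) ->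
  p \mPo [tuple g i | i < 3] \is (e * d)%N.-homog.
Proof.
move=> /dhomogP hp hg; rewrite comp_mpolyE big_seq; apply: rpred_sum => m mp.
apply: rpredZ; rewrite -(hp m mp) /= mdegE big_distrr /=.
elim/big_rec2: _ => [|i k q _ IH]; first exact: dhomog1.
by apply: dhomogM => //; rewrite tnth_mktuple; apply: dhomogMn.
Qed.

Lemma regular_id : regular id.
Proof.
move=> P; exists 1%N, (fun i => 'X_i); split.
- by move=> i; rewrite dhomogX /= mdeg1.
- case: P => [|x y h].
    by exists (@Ordinal 3 1 isT); rewrite mevalXU /= oner_neq0.
  by exists (@Ordinal 3 2 isT); rewrite mevalXU /= oner_neq0.
- by move=> Q _; exists 1; rewrite ?oner_neq0 // => i; rewrite mevalXU mul1r.
Qed.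

Lemma regular_comp phi psi : regular phi -> regular psi -> regular (phi \o psi).
Proof.
move=> rphi rpsi P.
have [e [g [hg [j gj] gQ]]] := rpsi P.
have [d [f [hf [i fi] fQ]]] := rphi (psi P).
have fgE k Q c : (forall i, (g i).@[hcoord Q] = c * hcoord (psi Q) i) ->
    (f k \mPo [tuple g i | i < 3]).@[hcoord Q]
      = c ^+ d * (f k).@[hcoord (psi Q)].
  move=> gc; rewrite comp_mpoly_meval -(meval_homog _ _ (hf k)).
  by apply: meval_eq => l; rewrite tnth_mktuple gc.
have gE Q : exists c, forall i, (g i).@[hcoord Q] = c * hcoord (psi Q) i.
  have [/(gQ Q)[c _ gc]|/forallNP g0] :=
    pselect (exists i, (g i).@[hcoord Q] != 0); first by exists c.
  exists 0 => k; rewrite mul0r; apply/eqP.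
  by have /negP := g0 k; rewrite negbK.
exists (e * d)%N, (fun k => f k \mPo [tuple g i | i < 3]); split.
- by move=> k; apply: comp_homog.
- have [c c0 gc] := gQ P (ex_intro _ j gj).
  by exists i; rewrite (fgE _ _ c gc) mulf_neq0 // expf_neq0.
- move=> Q [k]; have [c gc] := gE Q; rewrite (fgE _ _ c gc) mulf_eq0 negb_or.
  case/andP => cd0 fk; have [c' c'0 fc] := fQ (psi Q) (ex_intro _ k fk).
  exists (c ^+ d * c'); first by rewrite mulf_neq0.
  by move=> l; rewrite (fgE _ _ c gc) fc mulrA.
Qed.

Definition aut_one : curveAut.
Proof. by exists id id => //; exact: regular_id. Defined.

Definition aut_comp (a b : curveAut) : curveAut.
Proof.
exists (a \o b) (aut_inv b \o aut_inv a).
- by move=> P /=; rewrite !aut_funK.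
- by move=> P /=; rewrite !aut_invK.
- by apply: regular_comp; exact: aut_regular.
- by apply: regular_comp; exact: aut_inv_regular.
- by rewrite /= !aut_origin.
Defined.

Definition aut_opp (a : curveAut) : curveAut.
Proof.
exists (aut_inv a) a.
- exact: aut_invK.
- exact: aut_funK.
- exact: aut_inv_regular.
- exact: aut_regular.
- by rewrite -{1}(aut_origin a) aut_funK.
Defined.

HB.instance Definition _ := gen_eqMixin curveAut.
HB.instance Definition _ := gen_choiceMixin curveAut.

Lemma aut_compA : associative aut_comp.
Proof. by move=> a b c; apply: curveAutP. Qed.
Lemma aut_comp1a : left_id aut_one aut_comp.
Proof. by move=> a; apply: curveAutP. Qed.
Lemma aut_compa1 : right_id aut_one aut_comp.
Proof. by move=> a; apply: curveAutP. Qed.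
Lemma aut_compVa : left_inverse aut_one aut_opp aut_comp.
Proof. by move=> a; apply: curveAutP => P; exact: aut_funK. Qed.
Lemma aut_compaV : right_inverse aut_one aut_opp aut_comp.
Proof. by move=> a; apply: curveAutP => P; exact: aut_invK. Qed.

HB.instance Definition _ := isGroup.Build curveAut
  aut_compA aut_comp1a aut_compa1 aut_compVa aut_compaV.

Lemma on_curve_neg x y :
  on_curve W x y -> on_curve W x (- y - wa1 W * x - wa3 W).
Proof. by rewrite /on_curve => /eqP <-; apply/eqP; ring. Qed.

Definition neg_point P : point W :=
  match P with
  | Origin => Origin
  | Affine x y h => Affine (on_curve_neg h)
  end.

Lemma neg_pointK : involutive neg_point.
Proof. by case=> [|x y h] //=; apply: affine_eq => //; ring. Qed.

Lemma regular_neg_point : regular neg_point.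
Proof.
pose o k (h : (k < 3)%N) := Ordinal h.
pose X0 : {mpoly F[3]} := 'X_(@o 0%N isT).
pose X1 : {mpoly F[3]} := 'X_(@o 1%N isT).
pose X2 : {mpoly F[3]} := 'X_(@o 2%N isT).
pose f : 'I_3 -> {mpoly F[3]} :=
  tnth [tuple X0; - X1 - wa1 W *: X0 - wa3 W *: X2; X2].
have f0 v : (f (@o 0%N isT)).@[v] = v (@o 0%N isT) by exact: mevalXU.
have f2 v : (f (@o 2%N isT)).@[v] = v (@o 2%N isT) by exact: mevalXU.
have f1 v : (f (@o 1%N isT)).@[v] =
    - v (@o 1%N isT) - wa1 W * v (@o 0%N isT) - wa3 W * v (@o 2%N isT).
  by rewrite /f /tnth /= !mevalB mevalN !mevalZ !mevalXU.
have ind (T : 'I_3 -> Prop) :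
    T (@o 0%N isT) -> T (@o 1%N isT) -> T (@o 2%N isT) -> forall i, T i.
  move=> t0 t1 t2 [[|[|[|//]]] h].
  - by rewrite (_ : Ordinal h = @o 0%N isT) //; exact: val_inj.
  - by rewrite (_ : Ordinal h = @o 1%N isT) //; exact: val_inj.
  - by rewrite (_ : Ordinal h = @o 2%N isT) //; exact: val_inj.
have hX i : 'X_i \is [in F[3], 1.-homog] by rewrite dhomogX /= mdeg1.
move=> P; exists 1%N, f; split.
- apply: ind; rewrite /f /tnth /=; do ?exact: hX.
  by rewrite !rpredB ?rpredN ?rpredZ //; exact: hX.
- case: P => [|x y h].
    exists (@o 1%N isT); rewrite f1 /hcoord /tnth /= !mulr0 !subr0.
    by rewrite oppr_eq0 oner_neq0.
  by exists (@o 2%N isT); rewrite f2 /= oner_neq0.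
- move=> [|x y h] _.
    exists (- 1); first by rewrite oppr_eq0 oner_neq0.
    by apply: ind; rewrite ?f0 ?f1 ?f2 /hcoord /tnth /=; ring.
  exists 1; first exact: oner_neq0.
  by apply: ind; rewrite ?f0 ?f1 ?f2 /hcoord /tnth /=; ring.
Qed.

Definition aut_neg : curveAut :=
  CurveAut neg_pointK neg_pointK regular_neg_point regular_neg_point erefl.

(* The natural powers of -1 already form a group, as -1 is an involution. *)
Definition neg_pred : {pred curveAut} :=
  fun a => `[< exists n : nat, a = (aut_neg ^+ n)%g >].

Lemma aut_negV : (aut_neg^-1)%g = aut_neg.
Proof. exact: curveAutP. Qed.

Lemma neg_pred_closed : group_closed neg_pred.
Proof.
split; first by apply/asboolP; exists 0%N; rewrite expg0.
move=> a b /asboolP[m ->] /asboolP[n ->]; apply/asboolP; exists (m + n)%N.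
by rewrite -expVgn aut_negV expgnDr.
Qed.

Definition negGroup := {a : curveAut | neg_pred a}.

HB.instance Definition _ := SubChoice.on negGroup.
HB.instance Definition _ :=
  SubChoice_isSubGroup.Build curveAut neg_pred negGroup neg_pred_closed.

End Automorphisms.

Section GaloisAction.
Variables (K L : fieldType) (iota : {rmorphism K -> L}) (E : weierstrass K).
Local Notation G := (galGroup iota).
Local Notation EL := (weierstrass_map iota E).
Implicit Types (s t : G) (P Q : point EL).

Lemma on_curve_gal s x y : on_curve EL x y -> on_curve EL (s x) (s y).
Proof.
move=> /eqP /(congr1 s); rewrite !(rmorphD, rmorphM, rmorphXn) /= !gal_fix.
by move=> e; apply/eqP.
Qed.

Definition gal_point s P : point EL :=
  match P with
  | Origin => Origin
  | Affine x y h => Affine (on_curve_gal s h)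
  end.

Lemma gal_point1 P : gal_point 1%g P = P.
Proof. by case: P => [|x y h] //=; exact: affine_eq. Qed.

Lemma gal_pointM s t P : gal_point (s * t)%g P = gal_point s (gal_point t P).
Proof. by case: P => [|x y h] //=; exact: affine_eq. Qed.

Lemma gal_pointK s : cancel (gal_point s) (gal_point s^-1%g).
Proof. by move=> P; rewrite -gal_pointM mulVg gal_point1. Qed.

Lemma gal_pointVK s : cancel (gal_point s^-1%g) (gal_point s).
Proof. by move=> P; rewrite -gal_pointM mulgV gal_point1. Qed.

Lemma hcoord_gal s P i : hcoord (gal_point s P) i = s (hcoord P i).
Proof.
case: P => [|x y h]; case: i => [[|[|[|//]]] h'];
  by rewrite /hcoord /tnth /= ?rmorph0 ?rmorph1.
Qed.

Lemma meval_gal s (p : {mpoly L[3]}) (v : 'I_3 -> L) :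
  (map_mpoly s p).@[fun i => s (v i)] = s p.@[v].
Proof.
rewrite !mevalE rmorph_sum /=.
rewrite (perm_big _ (msupp_map_mpoly _ (can_inj (gal_funK s)))) /=.
apply: eq_bigr => m _; rewrite mcoeff_map_mpoly rmorphM /= rmorph_prod /=.
by congr (_ * _); apply: eq_bigr => i _; rewrite rmorphXn.
Qed.

(* The natural action on maps between sets of points:
   (s phi)(P) = s (phi (s^-1 P)). *)
Definition gal_map s (phi : point EL -> point EL) : point EL -> point EL :=
  fun P => gal_point s (phi (gal_point s^-1%g P)).

Lemma regular_gal s (phi : point EL -> point EL) :
  regular phi -> regular (gal_map s phi).
Proof.
move=> rphi P; have [d [f [hf [i fi] fQ]]] := rphi (gal_point s^-1%g P).
have fE k Q : (map_mpoly s (f k)).@[hcoord Q]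
    = s (f k).@[hcoord (gal_point s^-1%g Q)].
  rewrite -meval_gal; apply: meval_eq => l.
  by rewrite -hcoord_gal gal_pointVK.
exists d, (fun k => map_mpoly s (f k)); split.
- move=> k; apply/dhomogP => m.
  rewrite (perm_mem (msupp_map_mpoly _ (can_inj (gal_funK s)))).
  by move/dhomogP: (hf k); apply.
- by exists i; rewrite fE fmorph_eq0.
- move=> Q [k]; rewrite fE fmorph_eq0 => fk.
  have [c c0 fc] := fQ _ (ex_intro _ k fk).
  exists (s c); first by rewrite fmorph_eq0.
  by move=> l; rewrite fE fc rmorphM /= -hcoord_gal.
Qed.

Definition gal_aut s (a : curveAut EL) : curveAut EL.
Proof.
exists (gal_map s a) (gal_map s (aut_inv a)).
- by move=> P; rewrite /gal_map gal_pointK aut_funK gal_pointVK.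
- by move=> P; rewrite /gal_map gal_pointK aut_invK gal_pointVK.
- exact/regular_gal/aut_regular.
- exact/regular_gal/aut_inv_regular.
- by rewrite /gal_map /= aut_origin.
Defined.

Lemma gal_aut1 (a : curveAut EL) : gal_aut 1%g a = a.
Proof.
by apply: curveAutP => P; rewrite /= /gal_map invg1 !gal_point1.
Qed.

Lemma gal_autA s t (a : curveAut EL) :
  gal_aut (s * t)%g a = gal_aut s (gal_aut t a).
Proof.
by apply: curveAutP => P; rewrite /= /gal_map invgM !gal_pointM.
Qed.

Lemma gal_autM s : {morph gal_aut s : a b / (a * b)%g}.
Proof.
by move=> a b; apply: curveAutP => P; rewrite /= /gal_map gal_pointK.
Qed.

Definition autModule : galModule iota :=
  GalModule gal_aut1 gal_autA gal_autM.

Lemma gal_aut_neg s : gal_aut s (aut_neg EL) = aut_neg EL.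
Proof.
apply: curveAutP => P; rewrite -{2}(gal_pointVK s P) /= /gal_map.
case: (gal_point _ P) => [|x y h] //=; apply: affine_eq => //.
by rewrite !(rmorphB, rmorphN, rmorphM) /= !gal_fix.
Qed.

Lemma gal_aut_negX s n : gal_aut s (aut_neg EL ^+ n)%g = (aut_neg EL ^+ n)%g.
Proof.
elim: n => [|n IH]; first exact: (@gm_act_1 _ _ _ autModule).
by rewrite expgS gal_autM IH gal_aut_neg.
Qed.

Lemma neg_pred_gal s (a : negGroup EL) : neg_pred (gal_aut s (val a)).
Proof.
by case: a => a /= /asboolP[n ->]; apply/asboolP; exists n; rewrite gal_aut_negX.
Qed.

Definition gal_neg s (a : negGroup EL) : negGroup EL := Sub _ (neg_pred_gal s a).

Lemma gal_neg1 (a : negGroup EL) : gal_neg 1%g a = a.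
Proof. by apply: val_inj; rewrite SubK gal_aut1. Qed.

Lemma gal_negA s t (a : negGroup EL) :
  gal_neg (s * t)%g a = gal_neg s (gal_neg t a).
Proof. by apply: val_inj; rewrite !SubK gal_autA. Qed.

Lemma gal_negM s : {morph gal_neg s : a b / (a * b)%g}.
Proof.
move=> a b; apply: val_inj.
exact: (gal_autM s (val a) (val b)).
Qed.

Definition negModule : galModule iota :=
  GalModule gal_neg1 gal_negA gal_negM.

Definition neg_incl : galHom negModule autModule :=
  @GalHom _ _ _ negModule autModule (fun a : negGroup EL => val a)
    (fun a b => valM a b) (fun s a => erefl).

End GaloisAction.

(* Main.v *)
Require Import Defs.
From mathcomp Require Import all_boot all_algebra.
From mathcomp Require Import boolp classical_sets.
From mathcomp Require Import fieldext separable mxpoly mpoly ring zify.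
From mathcomp Require Import topology_structure discrete_topology.

Set Implicit Arguments.
Unset Strict Implicit.
Unset Printing Implicit Defensive.

Import GRing.Theory.
Local Open Scope ring_scope.

(** Write [A] for the automorphism group of the curve over [L].  If the classes
    of two characters [c, d] of the Galois group with values in [<-1>] become
    equal over [A], then [d s = a^-1 * c s * s(a)] for some [a : A], and as [A]
    is abelian this says that [s(a)] is [a] or [- a], according to whether
    [c s = d s].  So the map fails to be injective exactly when some [a] which
    is not fixed by Galois satisfies [s(a) = a] or [s(a) = - a] for every [s]
    ([neg_incl_injective], [neg_incl_not_injective]).

    The automorphisms are known explicitly ([aut_acts_as]): they are the
    substitutions [x -> u^2 x + r], [y -> u^3 y + u^2 s x + t] which preserve the
    Weierstrass equation.  A regular bijection fixing the origin transforms the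
    coordinates [x], [y] into functions which are locally quotients of
    polynomials on the affine curve, hence are of the form [P(x) + Q(x) y]
    ([locally_polyfun]); comparing the pole orders at the origin for the
    bijection and for its inverse shows that these orders remain 2 and 3
    ([aut_has_deg]), which leaves only the affine substitutions.

    Suppose now [s(a) = - a] and [a <> - a].  In terms of the parameters this
    gives [s(u) = - u].
    - In characteristic other than 2, invariance of [c6] gives [u^6 c6 = c6];
      if [c6] were not 0, then [u^3] would be 1 or -1, hence fixed by [s], while
      [s(u^3) = - u^3].  So [c6 = 0], that is [j = 1728] outside characteristic
      3 ([twist_c6]).
    - In characteristic 3, [c6 = 0] makes the curve supersingular, and there is
      a translation [x -> x + d], [d <> 0], which does not commute with [a]
      ([char3_supersingular]).
    - In characteristic 2, either [a1 <> 0] and the equations for the parameters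
      force [s(a) = a], or [a1 = 0] and the curve is supersingular, with two
      explicit automorphisms which do not commute ([char2_supersingular]).
    Conversely, when [j = 1728] outside characteristics 2 and 3, an automorphism
    [b] is determined by [u], and [u^4 = 1]; if [b] is not fixed by Galois then
    [u^2 = -1], so that every [s] maps [u] to [u] or [- u] and [b] to [b] or
    [- b] ([exceptional_twist]). *)

(** * Algebraic closedness of the separable closure of a perfect field *)

Definition alg_closed (F : fieldType) : Prop :=
  forall p : {poly F}, (1 < size p)%N -> exists x, root p x.

(** The polynomial of least degree vanishing at [z] is irreducible. *)
Lemma irreducible_with_root (F E : fieldType) (f : {rmorphism F -> E})
    (p : {poly F}) z :
  p != 0 -> root (map_poly f p) z ->
  exists2 q : {poly F}, irreducible_poly q & root (map_poly f q) z.
Proof.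
have [n] := ubnP (size p); elim: n p => // n IH p lpn p0 pz.
have p1 : (1 < size p)%N.
  rewrite ltnNge; apply/negP => /size1_polyC pc; move: pz p0.
  by rewrite pc map_polyC rootC fmorph_eq0 polyC_eq0 => ->.
have [[q [q0 qp qz]]|nq] := pselect (exists q : {poly F},
    [/\ q != 0, (size q < size p)%N & root (map_poly f q) z]).
  by apply: IH qz => //; rewrite ltnS in lpn; exact: leq_trans lpn.
exists p => //; split=> // q q1 qp.
have q0 : q != 0 by apply: contraNneq p0 => q0; rewrite q0 dvd0p in qp.
rewrite -dvdp_size_eqp // eqn_leq dvdp_leq //= leqNgt; apply/negP => lqp.
have := qp; rewrite dvdp_eq => /eqP pE.
have d0 : p %/ q != 0 by apply: contraNneq p0 => d0; rewrite pE d0 mul0r.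
move: pz; rewrite pE rmorphM rootM => /orP[dz|qz]; apply: nq.
  exists (p %/ q); split=> //; rewrite size_divp //.
  rewrite ltn_subrL size_poly_gt0 p0 andbT.
  by rewrite -subn1 subn_gt0 ltn_neqAle eq_sym q1 size_poly_gt0.
by exists q.
Qed.

Lemma irreducible_dvdp_root (F E : fieldType) (f : {rmorphism F -> E})
    (p q : {poly F}) z :
  irreducible_poly q -> root (map_poly f q) z -> root (map_poly f p) z ->
  q %| p.
Proof.
move=> [_ irr_q] qz pz; have [co_qp|nco] := boolP (coprimep q p).
  have : coprimep (map_poly f q) (map_poly f p) by rewrite coprimep_map.
  by move=> /coprimep_root /(_ qz); rewrite -rootE pz.
by rewrite -(eqp_dvdl _ (irr_q _ nco (dvdp_gcdl q p))) dvdp_gcdr.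
Qed.

(** A polynomial [p] of least degree without a root would be irreducible, hence
    have a root [z] in a finite extension of [L].  Since [z] is algebraic over
    [K], its minimal polynomial over [K] is separable by perfectness, and [p]
    divides that polynomial, so that [p] is separable and has a root after
    all. *)
Lemma separable_closure_alg_closed (K L : fieldType)
    (iota : {rmorphism K -> L}) :
  perfect_field K -> is_separable_closure iota -> alg_closed L.
Proof.
move=> perfK [algL sepL] p.
have [n] := ubnP (size p); elim: n p => // n IH p lpn p1.
have [//|nroot] := pselect (exists x, root p x).
have p0 : p != 0 by rewrite -size_poly_gt0 ltnW.
have irr_p : irreducible_poly p.
  split=> // q q1 qp.
  have q0 : q != 0 by apply: contraNneq p0 => q0; rewrite q0 dvd0p in qp.
  rewrite -dvdp_size_eqp // eqn_leq dvdp_leq //= leqNgt; apply/negP => lqp.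
  have [||x qx] := IH q.
  - by rewrite ltnS in lpn; exact: leq_trans lpn.
  - by rewrite ltn_neqAle eq_sym q1 size_poly_gt0.
  by case: nroot; exists x; move: qp => /dvdpP[r ->]; rewrite rootM qx orbT.
have [M _ [z pz _]] := irredp_FAdjoin irr_p.
pose j : {rmorphism L -> M} := in_alg M.
pose k : {rmorphism K -> M} := j \o iota.
have [P P0 Pz] : algebraicOver k z.
  apply/integral_algebraic; apply: (@integral_root _ _ _ (map_poly j p)) => //.
    by rewrite map_poly_eq0.
  move=> _ /(nthP 0)[i _ <-]; rewrite coef_map; apply/integral_algebraic.
  have [q sq qx] := algL p`_i; exists q; first exact: separable_poly_neq0.
  by rewrite map_poly_comp; apply: rmorph_root.
have [q irr_q qz] := irreducible_with_root P0 Pz.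
apply: sepL p1; apply: (@dvdp_separable _ (map_poly iota q)).
  apply: (irreducible_dvdp_root irr_p pz).
  by rewrite -map_poly_comp.
by rewrite separable_map; exact: perfK.
Qed.

Lemma alg_closed_monic (F : fieldType) (n : nat) (q : {poly F}) :
  alg_closed F -> (0 < n)%N -> (size q <= n)%N -> exists x, x ^+ n = q.[x].
Proof.
move=> closedF n0 sq; have [|x] := closedF ('X^n - q).
  by rewrite size_polyDl size_polyXn // size_polyN ltnS.
by rewrite rootE hornerD hornerN hornerXn subr_eq0 => /eqP; exists x.
Qed.

Lemma alg_closed_quadratic (F : fieldType) (b c : F) :
  alg_closed F -> exists x, x ^+ 2 = b * x + c.
Proof.
move=> /alg_closed_monic closedF; have [//||x] := closedF 2%N (b *: 'X + c%:P).
  rewrite (leq_trans (size_polyD _ _)) // geq_max; apply/andP; split.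
    by rewrite (leq_trans (size_scale_leq _ _)) // size_polyX.
  by rewrite (leq_trans (size_polyC_leq1 _)).
by rewrite !hornerE; exists x.
Qed.

(** * Polynomial functions on the affine curve and their pole orders *)

Definition hornerDE := (hornerD, hornerN, hornerM, horner_exp, hornerZ,
  hornerXn, hornerX, hornerC).

Section CoordinateRing.
Variables (F : fieldType) (W : weierstrass F).
Hypothesis closedF : alg_closed F.
Implicit Types (A B C D : {poly F}) (P Q : Defs.point W)
  (h k : Defs.point W -> F).

Definition is_affine P : bool := if P is Affine _ _ _ then true else false.
Definition px P : F := if P is Affine x _ _ then x else 0.
Definition py P : F := if P is Affine _ y _ then y else 0.

(* Instances of the size lemmas at [F], in which all occurrences of [size]
   carry the same canonical structure; [lia] needs this. *)
Let sz_eq0 A : (size A == 0%N) = (A == 0).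
Proof. exact: size_poly_eq0. Qed.
Let sz_gt0 A : (0 < size A)%N = (A != 0).
Proof. exact: size_poly_gt0. Qed.
Let szM A B : A != 0 -> B != 0 -> size (A * B) = (size A + size B).-1.
Proof. exact: size_mul. Qed.
Let szM_leq A B : (size (A * B)%R <= (size A + size B).-1)%N.
Proof. exact: size_polyMleq. Qed.
Let szD_leq A B : (size (A + B)%R <= maxn (size A) (size B))%N.
Proof. exact: size_polyD. Qed.
Let szDl A B : (size B < size A)%N -> size (A + B) = size A.
Proof. exact: size_polyDl. Qed.

(** The curve is [y ^+ 2 + wlin.[x] * y = wcub.[x]].  Both polynomials are locked
    so that rewriting does not look inside them. *)
Definition wlin : {poly F} := locked (wa1 W *: 'X + (wa3 W)%:P).
Definition wcub : {poly F} :=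
  locked ('X^3 + (wa2 W *: 'X^2 + (wa4 W *: 'X + (wa6 W)%:P))).

Lemma wlinE x : wlin.[x] = wa1 W * x + wa3 W.
Proof. by rewrite /wlin -lock !hornerDE. Qed.

Lemma wcubE x : wcub.[x] = x ^+ 3 + wa2 W * x ^+ 2 + wa4 W * x + wa6 W.
Proof. by rewrite /wcub -lock !hornerDE; ring. Qed.

Lemma size_wcub : size wcub = 4%N.
Proof.
rewrite /wcub -lock szDl ?size_polyXn // ltnS.
rewrite (leq_trans (szD_leq _ _)) // geq_max; apply/andP; split.
  by rewrite (leq_trans (size_scale_leq _ _)) // size_polyXn.
rewrite (leq_trans (szD_leq _ _)) // geq_max; apply/andP; split.
  by rewrite (leq_trans (size_scale_leq _ _)) // size_polyX.
by rewrite (leq_trans (size_polyC_leq1 _)).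
Qed.

Lemma size_wlin : (size wlin <= 2)%N.
Proof.
rewrite /wlin -lock (leq_trans (szD_leq _ _)) // geq_max; apply/andP; split.
  by rewrite (leq_trans (size_scale_leq _ _)) // size_polyX.
by rewrite (leq_trans (size_polyC_leq1 _)).
Qed.

Lemma curve_eq P : is_affine P ->
  py P ^+ 2 = wcub.[px P] - wlin.[px P] * py P.
Proof.
case: P => //= x y /eqP e _; rewrite wlinE wcubE -e; ring.
Qed.

Lemma point_above x : exists2 P, is_affine P & px P = x.
Proof.
have [y] := alg_closed_quadratic (- wlin.[x]) wcub.[x] closedF.
rewrite wlinE wcubE => /eqP; rewrite -subr_eq0 => /eqP e.
have hy : on_curve W x y.
  by rewrite /on_curve -subr_eq0; apply/eqP; rewrite -[RHS]e; ring.
by exists (Affine hy).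
Qed.

(** The product of [A + B y] with its conjugate under [y -> - y - wlin]: the norm
    from the coordinate ring of the affine curve to polynomials in [x].  Its
    degree is the pole order of [A + B y] at the origin, which makes this order
    additive on products. *)
Definition normp A B : {poly F} := A ^+ 2 - A * B * wlin - B ^+ 2 * wcub.

Lemma normpM A B C D :
  normp (A * C + B * D * wcub) (A * D + B * C - B * D * wlin)
    = normp A B * normp C D.
Proof. by rewrite /normp; ring. Qed.

Lemma horner_normp A B P : is_affine P ->
  (normp A B).[px P] = (A.[px P] + B.[px P] * py P)
    * (A.[px P] + B.[px P] * (- py P - wlin.[px P])).
Proof.
by move=> /curve_eq e; rewrite /normp !hornerDE -[_ * wcub.[_]]opprK; ring: e.
Qed.

(** The orders of the poles of [A] and of [B y] are even and odd respectively, so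
    that the leading terms cannot cancel. *)
Lemma size_normp A B : size (normp A B) =
  maxn (size A).*2.-1 (if B == 0%R then 0 else (size B).*2.+2)%N.
Proof.
have sA : size (A ^+ 2) = (size A).*2.-1.
  have [->|A0] := eqVneq A 0; first by rewrite expr0n size_poly0.
  by rewrite expr2 szM // addnn.
have [->|B0] := eqVneq B 0.
  by rewrite /normp mulr0 mul0r expr0n mul0r !subr0 sA maxn0.
have sB : size (B ^+ 2 * wcub) = (size B).*2.+2.
  have w0 : wcub != 0 by rewrite -sz_eq0 size_wcub.
  rewrite szM ?expf_neq0 // size_wcub expr2 szM //.
  by move: B0; rewrite -sz_eq0; lia.
have sAB : (size (A * B * wlin)%R < maxn (size A).*2.-1 (size B).*2.+2)%N.
  have := szM_leq (A * B) wlin; have := szM_leq A B.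
  have := size_wlin; move: B0; rewrite -sz_eq0.
  have [->|] := eqVneq A 0; first by rewrite !mul0r size_poly0; lia.
  rewrite -sz_eq0; lia.
have -> : normp A B = (A ^+ 2 - B ^+ 2 * wcub) - A * B * wlin.
  by rewrite /normp; ring.
have sD : size (A ^+ 2 - B ^+ 2 * wcub) = maxn (size A).*2.-1 (size B).*2.+2.
  case: (ltngtP (size A).*2.-1 (size B).*2.+2) => lAB; last by lia.
    by rewrite addrC szDl size_polyN sB // sA.
  by rewrite szDl // size_polyN sA sB.
by rewrite szDl sD // size_polyN.
Qed.

Definition represents A B h : Prop :=
  forall P, is_affine P -> h P = A.[px P] + B.[px P] * py P.

Lemma representsD A B C D h k : represents A B h -> represents C D k ->
  represents (A + C) (B + D) (fun P => h P + k P).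
Proof. by move=> hAB kCD P aP; rewrite hAB // kCD // !hornerDE; ring. Qed.

Lemma representsM A B C D h k : represents A B h -> represents C D k ->
  represents (A * C + B * D * wcub) (A * D + B * C - B * D * wlin)
    (fun P => h P * k P).
Proof.
move=> hAB kCD P aP; rewrite hAB // kCD // !hornerDE; ring: (curve_eq aP).
Qed.

Lemma representsC c : represents c%:P 0 (fun=> c).
Proof. by move=> P _; rewrite !hornerDE; ring. Qed.

Lemma represents_px : represents 'X 0 px.
Proof. by move=> P _; rewrite !hornerDE; ring. Qed.

Lemma represents_py : represents 0 1 py.
Proof. by move=> P _; rewrite !hornerDE; ring. Qed.

Lemma poly_vanish A : (forall x, A.[x] = 0) -> A = 0.
Proof.
move=> A0; have [/size1_polyC Ac|lA] := leqP (size (A + 1)) 1.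
  have cA : A = ((A + 1)`_0 - 1)%:P by rewrite polyCB -Ac addrK.
  by have := A0 0; rewrite {1}cA hornerC => c0; rewrite cA c0.
have [x] := closedF lA.
by rewrite rootE hornerD A0 hornerC add0r oner_eq0.
Qed.

(** A function which vanishes on the curve has a norm with infinitely many
    roots. *)
Lemma represents0 A B : represents A B (fun=> 0) -> A = 0 /\ B = 0.
Proof.
move=> h0; have /eqP : normp A B = 0.
  apply: poly_vanish => x; have [P aP <-] := point_above x.
  by rewrite horner_normp // -h0 // mul0r.
rewrite -sz_eq0 size_normp => e.
have B0 : B = 0 by apply/eqP/negPn/negP => B0; move: e; rewrite (negPf B0); lia.
split=> //; apply/eqP; move: e.
by rewrite B0 eqxx -sz_eq0; lia.
Qed.

Lemma represents_inj A B C D h : represents A B h -> represents C D h ->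
  A = C /\ B = D.
Proof.
move=> hAB hCD; have /represents0[/eqP + /eqP] :
    represents (A - C) (B - D) (fun=> 0).
  move=> P aP; have := hAB P aP; rewrite hCD // => /eqP.
  by rewrite -subr_eq0 => /eqP e; rewrite -oppr0 -[in LHS]e !hornerDE; ring.
by rewrite !subr_eq0 => /eqP -> /eqP ->.
Qed.

(** [has_deg h n] : the function [h] is polynomial with a pole of order [n] at
    the origin; [deg_lt h n] allows any smaller order, and the zero function. *)
Definition has_deg h n : Prop :=
  exists A B, represents A B h /\ size (normp A B) = n.+1.
Definition deg_lt h n : Prop :=
  exists A B, represents A B h /\ (size (normp A B) <= n)%N.

Lemma has_degM h k m n : has_deg h m -> has_deg k n ->
  has_deg (fun P => h P * k P) (m + n).
Proof.
move=> [A [B [hAB sAB]]] [C [D [kCD sCD]]]; do 2!eexists; split.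
  exact: representsM hAB kCD.
by rewrite normpM szM -?sz_eq0 ?sAB ?sCD //= addnS.
Qed.

Lemma deg_ltM h k m n : deg_lt h m.+1 -> deg_lt k n.+1 ->
  deg_lt (fun P => h P * k P) (m + n).+1.
Proof.
move=> [A [B [hAB sAB]]] [C [D [kCD sCD]]]; do 2!eexists; split.
  exact: representsM hAB kCD.
by rewrite normpM (leq_trans (szM_leq _ _)) //; lia.
Qed.

Lemma deg_ltW h m n : (m <= n)%N -> deg_lt h m -> deg_lt h n.
Proof.
by move=> mn [A [B [hAB sAB]]]; exists A, B; split=> //; apply: leq_trans mn.
Qed.

Lemma has_deg_lt h m n : (m < n)%N -> has_deg h m -> deg_lt h n.
Proof. by move=> mn [A [B [hAB sAB]]]; exists A, B; rewrite sAB. Qed.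

Lemma deg_ltD h k n : deg_lt h n -> deg_lt k n ->
  deg_lt (fun P => h P + k P) n.
Proof.
move=> [A [B [hAB +]]] [C [D [kCD +]]] => + +.
rewrite !size_normp => sAB sCD; exists (A + C), (B + D); split.
  exact: representsD.
rewrite size_normp; have := szD_leq A C; have := szD_leq B D.
move: sAB sCD; rewrite -!sz_eq0.
by case: eqP => ?; case: eqP => ?; case: eqP => ?; lia.
Qed.

Lemma has_degD h k n : has_deg h n -> deg_lt k n ->
  has_deg (fun P => h P + k P) n.
Proof.
move=> [A [B [hAB +]]] [C [D [kCD +]]] => + +.
rewrite !size_normp => sAB sCD; exists (A + C), (B + D); split.
  exact: representsD.
rewrite size_normp; move: sAB sCD; rewrite -!sz_eq0.
have := szD_leq A C; have := szD_leq B D.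
have := @szDl A C; have := @szDl B D.
by case: eqP => ?; case: eqP => ?; case: eqP => ?; lia.
Qed.

Lemma has_degC c : c != 0 -> has_deg (fun=> c) 0.
Proof.
move=> c0; exists c%:P, 0; split; first exact: representsC.
by rewrite size_normp eqxx size_polyC c0.
Qed.

Lemma deg_ltC c n : deg_lt (fun=> c) n.+1.
Proof.
exists c%:P, 0; split; first exact: representsC.
by rewrite size_normp eqxx size_polyC; case: (c != 0).
Qed.

Lemma deg_ltZ c h n : deg_lt h n -> deg_lt (fun P => c * h P) n.
Proof.
case: n => [|n] [A [B [hAB sAB]]]; last first.
  by apply: (deg_ltM (m := 0)); [exact: deg_ltC | exists A, B].
exists (c *: A), (c *: B); split=> [P aP|].
  by rewrite hAB // !hornerDE; ring.
have -> : normp (c *: A) (c *: B) = c ^+ 2 *: normp A B.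
  by rewrite /normp -!mul_polyC; ring.
by apply: leq_trans sAB; exact: size_scale_leq.
Qed.

Lemma deg_lt_has_deg h n : has_deg h n -> deg_lt h n -> False.
Proof.
move=> [A [B [hAB sAB]]] [C [D [hCD]]].
by have [-> ->] := represents_inj hCD hAB; rewrite sAB ltnn.
Qed.

Lemma has_deg_inj h m n : has_deg h m -> has_deg h n -> m = n.
Proof.
move=> hm hn; case: (ltngtP m n) => // mn.
  by case: (deg_lt_has_deg hn); apply: has_deg_lt hm.
by case: (deg_lt_has_deg hm); apply: has_deg_lt hn.
Qed.

Lemma has_deg_eq h k n : (forall P, is_affine P -> h P = k P) ->
  has_deg h n -> has_deg k n.
Proof.
by move=> hk [A [B [hAB s]]]; exists A, B; split=> // P aP; rewrite -hk // hAB.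
Qed.

Lemma deg_lt_eq h k n : (forall P, is_affine P -> h P = k P) ->
  deg_lt h n -> deg_lt k n.
Proof.
by move=> hk [A [B [hAB s]]]; exists A, B; split=> // P aP; rewrite -hk // hAB.
Qed.

Lemma has_deg_px : has_deg px 2.
Proof.
exists 'X, 0; split; first exact: represents_px.
by rewrite size_normp size_polyX eqxx.
Qed.

Lemma has_deg_horner A h n : A != 0 -> has_deg h n.+1 ->
  has_deg (fun P => A.[h P]) (n.+1 * (size A).-1).
Proof.
move=> + hn; elim/poly_ind: A => [|A c IH]; first by rewrite eqxx.
rewrite size_MXaddC; have [->|A0] := eqVneq A 0.
  rewrite mul0r add0r polyC_eq0 => c0; rewrite (negPf c0) /= size_poly0 muln0.
  by apply: has_deg_eq (has_degC c0) => P _; rewrite hornerC.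
move=> _ /=; rewrite polySpred //= mulnSr.
apply: (@has_deg_eq (fun P => A.[h P] * h P + c)).
  by move=> P _; rewrite hornerMXaddC.
apply: has_degD; first by apply: has_degM => //; exact: IH.
by rewrite addnS; exact: deg_ltC.
Qed.

(** Pole orders are multiplied by [d.+1] under a substitution which multiplies
    the pole orders of [x] and [y] by [d.+1]: those of [A.[h]] and [B.[h] * k] are
    an even and an odd multiple of [d.+1], so that there is no cancellation. *)
Lemma has_deg_comp A B h k d n : has_deg h (2 * d.+1) -> has_deg k (3 * d.+1) ->
  size (normp A B) = n.+1 ->
  has_deg (fun P => A.[h P] + B.[h P] * k P) (d.+1 * n).
Proof.
have -> : (2 * d.+1 = (2 * d).+1.+1)%N by lia.
move=> hh hk; rewrite size_normp.
have [->|B0] := eqVneq B 0.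
  rewrite maxn0 => sA; have A0 : A != 0 by rewrite -sz_eq0; lia.
  have -> : (d.+1 * n = (2 * d).+2 * (size A).-1)%N.
    by rewrite (_ : n = 2 * (size A).-1)%N; lia.
  apply: has_deg_eq (has_deg_horner A0 hh) => P _.
  by rewrite horner0 mul0r addr0.
have hB := has_degM (has_deg_horner B0 hh) hk.
have [->|A0] := eqVneq A 0.
  rewrite size_poly0 max0n => -[nE].
  move: B0; rewrite -sz_gt0 => B0.
  have <- : ((2 * d).+2 * (size B).-1 + 3 * d.+1 = d.+1 * n)%N.
    by rewrite -nE -[(size B).*2]muln2; nia.
  by apply: has_deg_eq hB => P _; rewrite horner0 add0r.
have hA := has_deg_horner A0 hh.
move: A0 B0; rewrite -!sz_gt0 => A0 B0.
case: (leqP (size A).*2.-1 (size B).*2.+2) => lAB nE.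
  have <- : ((2 * d).+2 * (size B).-1 + 3 * d.+1 = d.+1 * n)%N.
    by case: nE => <-; rewrite -[(size B).*2]muln2; nia.
  apply: has_deg_eq (has_degD hB _); first by move=> P _; rewrite addrC.
  apply: has_deg_lt hA.
  move: lAB; case: (size A) A0 => // a _; case: (size B) B0 => // b _ /=; nia.
have <- : ((2 * d).+2 * (size A).-1 = d.+1 * n)%N.
  by rewrite (_ : n = 2 * (size A).-1)%N; lia.
apply: (has_degD hA); apply: has_deg_lt hB.
move: lAB; case: (size A) A0 => // a _; case: (size B) B0 => // b _ /=; nia.
Qed.

End CoordinateRing.

(** * Regular functions on the affine curve are polynomial *)

Section RegularFunctions.
Variables (F : fieldType) (W : weierstrass F).
Hypothesis closedF : alg_closed F.
Implicit Types (A B C D : {poly F}) (P Q : Defs.point W)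
  (h k : Defs.point W -> F).

Definition polyfun h : Prop := exists A B, represents A B h.

Lemma polyfun_eq h k : (forall P, is_affine P -> h P = k P) ->
  polyfun h -> polyfun k.
Proof.
by move=> hk [A [B hAB]]; exists A, B => P aP; rewrite -hk // hAB.
Qed.

Lemma polyfunD h k : polyfun h -> polyfun k -> polyfun (fun P => h P + k P).
Proof.
by move=> [A [B hAB]] [C [D kCD]]; do 2!eexists; exact: representsD hAB kCD.
Qed.

Lemma polyfunM h k : polyfun h -> polyfun k -> polyfun (fun P => h P * k P).
Proof.
by move=> [A [B hAB]] [C [D kCD]]; do 2!eexists; exact: representsM hAB kCD.
Qed.

Lemma polyfunC c : polyfun (fun=> c).
Proof. by do 2!eexists; exact: representsC. Qed.

Lemma polyfun_px : polyfun (@px F W).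
Proof. by do 2!eexists; exact: represents_px. Qed.

Lemma polyfun_py : polyfun (@py F W).
Proof. by do 2!eexists; exact: represents_py. Qed.

Lemma polyfunX h n : polyfun h -> polyfun (fun P => h P ^+ n).
Proof.
move=> hh; elim: n => [|n IH]; first exact: polyfunC.
by apply: polyfun_eq (polyfunM hh IH) => P _; rewrite exprS.
Qed.

Lemma polyfun_horner A h : polyfun h -> polyfun (fun P => A.[h P]).
Proof.
move=> hh; elim/poly_ind: A => [|A c IH].
  by apply: polyfun_eq (polyfunC 0) => P _; rewrite horner0.
apply: polyfun_eq (polyfunD (polyfunM IH hh) (polyfunC c)) => P _.
by rewrite hornerMXaddC.
Qed.

Lemma py_neg_point P : is_affine P ->
  py (neg_point P) = - py P - (wlin W).[px P].
Proof. by case: P => //= x y e _; rewrite wlinE; ring. Qed.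

Lemma px_neg_point P : px (neg_point P) = px P.
Proof. by case: P. Qed.

Lemma affine_neg_point P : is_affine (neg_point P) = is_affine P.
Proof. by case: P. Qed.

Lemma polyfun_neg h : polyfun h -> polyfun (fun P => h (neg_point P)).
Proof.
move=> [A [B hAB]]; exists (A - B * wlin W), (- B) => P aP.
rewrite hAB ?affine_neg_point // px_neg_point py_neg_point // !hornerDE; ring.
Qed.

Lemma polyfun_norm h : polyfun h ->
  exists N : {poly F},
    forall P, is_affine P -> h P * h (neg_point P) = N.[px P].
Proof.
move=> [A [B hAB]]; exists (normp W A B) => P aP.
by rewrite horner_normp // !hAB ?affine_neg_point // px_neg_point py_neg_point.
Qed.

Lemma polyfun_meval (f : {mpoly F[3]}) : polyfun (fun P => f.@[hcoord P]).
Proof.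
have hX i : polyfun (fun P => hcoord P i).
  case: i => [[|[|[|//]]] i3].
  - by apply: polyfun_eq polyfun_px => -[].
  - by apply: polyfun_eq polyfun_py => -[].
  - by apply: polyfun_eq (polyfunC 1) => -[].
elim/mpolyind: f => [|c m p _ _ IH].
  by apply: polyfun_eq (polyfunC 0) => P _; rewrite meval0.
apply: (polyfun_eq (h := fun P => c * 'X_[m].@[hcoord P] + p.@[hcoord P])).
  by move=> P _; rewrite mevalD mevalZ.
apply: polyfunD IH; apply: polyfunM; first exact: polyfunC.
apply: (polyfun_eq (h := fun P => \prod_(i < 3) hcoord P i ^+ m i)).
  by move=> P _; rewrite mevalX.
elim: (index_enum _) => [|i s IH].
  by apply: polyfun_eq (polyfunC 1) => P _; rewrite big_nil.
apply: (polyfun_eq _ (polyfunM (polyfunX (m i) (hX i)) IH)) => P _.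
by rewrite big_cons.
Qed.

(** The polynomials [q] in [x] such that [h * q] is polynomial form an ideal.
    Norms of denominators of [h] belong to it, and at each value of [x] some
    denominator is nonzero at both points [P] and [- P] above (the sum of one
    which is nonzero at [P] and one at [- P], if need be).  So the ideal has no
    common zero, and its generator is constant. *)
Lemma locally_polyfun h :
  (forall P, is_affine P -> exists g, [/\ polyfun g, g P != 0 &
     polyfun (fun Q => h Q * g Q)]) ->
  polyfun h.
Proof.
move=> loc_h; pose I (q : {poly F}) := polyfun (fun Q => h Q * q.[px Q]).
have I_nz x : exists2 q, I q & q.[x] != 0.
  have [P aP <-] := point_above W closedF x.
  have [g [pg gP gN]] : exists g, [/\ polyfun g, polyfun (fun Q => h Q * g Q)
      & g P != 0 /\ g (neg_point P) != 0].
    have [g1 [pg1 g1P hg1]] := loc_h P aP.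
    have [|g2 [pg2 g2P hg2]] := loc_h (neg_point P).
      by rewrite affine_neg_point.
    have [e1|] := eqVneq (g1 (neg_point P)) 0; last by exists g1.
    have [e2|] := eqVneq (g2 P) 0; last by exists g2.
    exists (fun Q => g1 Q + g2 Q); split; first exact: polyfunD.
      by apply: polyfun_eq (polyfunD hg1 hg2) => Q _; rewrite mulrDr.
    by rewrite e1 e2 addr0 add0r.
  have [N gNE] := polyfun_norm pg.
  exists N; last by rewrite -gNE // mulf_neq0 //; case: gN.
  apply: polyfun_eq (polyfunM gP (polyfun_neg pg)) => Q aQ.
  by rewrite -mulrA gNE.
have I_mod p q : I p -> I q -> I (p %% q).
  move=> Ip Iq; have := polyfunM (polyfun_horner (- (p %/ q)) polyfun_px) Iq.
  move=> /(polyfunD Ip); apply: polyfun_eq => Q _.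
  have -> : p %% q = p - p %/ q * q by rewrite {2}(divp_eq p q) addrC addKr.
  by rewrite !hornerDE; ring.
have [d [Id d0 dmin]] : exists d, [/\ I d, d != 0 & forall q, I q -> d %| q].
  have [q0 Iq0 q00] := I_nz 0.
  have {}q00 : q0 != 0 by apply: contraNneq q00 => ->; rewrite horner0.
  have [n] := ubnP (size q0); elim: n q0 Iq0 q00 => // n IH d Id d0 ldn.
  have [[q [Iq nq]]|nex] := pselect (exists q, I q /\ ~~ (d %| q)); last first.
    by exists d; split=> // q Iq; apply/negPn/negP => nq; apply: nex; exists q.
  apply: (IH (q %% d)); [exact: I_mod | exact: nq |].
  by rewrite ltnS in ldn; apply: leq_trans ldn; rewrite ltn_modp.
have : size d = 1%N.
  apply/eqP; rewrite eqn_leq size_poly_gt0 d0 andbT leqNgt; apply/negP.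
  move=> /closedF[x dx]; have [q /dmin dq /negP[]] := I_nz x.
  by rewrite -rootE; move: dx; rewrite -!dvdp_XsubCl => /dvdp_trans; apply.
move=> /eqP/size_poly1P[c c0 dc].
apply: polyfun_eq (polyfunM Id (polyfunC c^-1)) => Q _.
by rewrite dc hornerC mulfK.
Qed.

Lemma aut_affine (a : curveAut W) P : is_affine P -> is_affine (a P).
Proof.
case: P => // x y e _; case E: (a _) => //.
by have := aut_funK a (Affine e); rewrite E -(aut_origin a) aut_funK.
Qed.

(** Around a point the automorphism is given by three forms, and the last one is
    a denominator for the affine coordinates of the image. Where the three forms
    vanish together the required identity is [0 = 0]. *)
Lemma aut_locally_polyfun (a : curveAut W) (i : 'I_3) :
  polyfun (fun P => hcoord (a P) i).
Proof.
apply: locally_polyfun => P0 aP0.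
have [d [f [_ f0 fQ]]] := aut_regular a P0.
have f2 (z := ord_max : 'I_3) Q c : is_affine Q ->
    (forall i, (f i).@[hcoord Q] = c * hcoord (a Q) i) ->
    (f z).@[hcoord Q] = c.
  move=> /(aut_affine a) aQ ->; case: (a Q) aQ => // x y e _.
  by rewrite mulr1.
exists (fun P => (f ord_max).@[hcoord P]); split.
- exact: polyfun_meval.
- by have [c c0 /f2 ->] := fQ P0 f0.
apply: polyfun_eq (polyfun_meval (f i)) => Q aQ.
have [[j fj]|nj] := pselect (exists j, (f j).@[hcoord Q] != 0).
  have [c c0 fc] := fQ Q (ex_intro _ j fj).
  by rewrite (f2 Q c) // fc mulrC.
have fj0 j : (f j).@[hcoord Q] = 0.
  by apply/eqP/negPn/negP => fj; apply: nj; exists j.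
by rewrite !fj0 mulr0.
Qed.

Lemma polyfun_aut_px (a : curveAut W) : polyfun (fun P => px (a P)).
Proof.
apply: polyfun_eq (aut_locally_polyfun a ord0) => P /(aut_affine a).
by case: (a P).
Qed.

Lemma polyfun_aut_py (a : curveAut W) : polyfun (fun P => py (a P)).
Proof.
have := aut_locally_polyfun a (@Ordinal 3 1 isT).
by apply: polyfun_eq => P /(aut_affine a); case: (a P).
Qed.

Lemma aut_oppK (a : curveAut W) P : a (aut_opp a P) = P.
Proof. exact: aut_invK. Qed.

Lemma represents_const A B h :
  represents A B h -> (size (normp W A B) <= 1)%N ->
  exists c, forall P, is_affine P -> h P = c.
Proof.
move=> hAB; rewrite size_normp.
have [B0|B0] := eqVneq B 0; last by rewrite geq_max andbF.
rewrite maxn0 => sA; have /size1_polyC Ac : (size A <= 1)%N by lia.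
by exists A`_0 => P aP; rewrite hAB // B0 {1}Ac hornerC horner0 mul0r addr0.
Qed.

(** The pole orders [n] of [x] and [m] of [y] after composition with [a] satisfy
    [2 * m = 3 * n], by the equation of the curve. The order [n] is positive
    since [a] is onto, so that [px (a P)] is not constant. *)
Lemma aut_has_deg (a : curveAut W) : exists d,
  has_deg (fun P => px (a P)) (2 * d.+1) /\
  has_deg (fun P => py (a P)) (3 * d.+1).
Proof.
set X := fun P => px (a P); set Y := fun P => py (a P).
have [n n0 Xn] : exists2 n, (0 < n)%N & has_deg X n.
  have [A [B XAB]] := polyfun_aut_px a.
  have [sz|sz] := leqP (size (normp W A B)) 1; last first.
    exists (size (normp W A B)).-1; first by lia.
    by exists A, B; split=> //; rewrite prednK // ltnW.
  have [c Xc] := represents_const XAB sz.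
  have [Q aQ Qc] := point_above W closedF (c + 1).
  have := Xc (aut_opp a Q) (aut_affine (aut_opp a) aQ).
  rewrite /X aut_oppK Qc => /eqP.
  by rewrite -subr_eq0 addrAC subrr add0r oner_eq0.
have E P : is_affine P -> Y P * (Y P + (wa1 W * X P + wa3 W)) =
    X P * X P * X P + (wa2 W * (X P * X P) + (wa4 W * X P + wa6 W)).
  move=> /(aut_affine a)/curve_eq; rewrite wcubE wlinE -/(X P) -/(Y P) => e.
  by ring: e.
have X1 : deg_lt X n.+1 by apply: has_deg_lt Xn.
have linX c c' : deg_lt (fun P => c * X P + c') n.+1.
  by apply: deg_ltD; [exact: deg_ltZ | exact: deg_ltC].
have R3 : has_deg (fun P => X P * X P * X P +
    (wa2 W * (X P * X P) + (wa4 W * X P + wa6 W))) (n + n + n).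
  apply: has_degD; first by apply: has_degM => //; exact: has_degM.
  apply: (@deg_ltW _ _ _ (n + n).+1); first lia.
  apply: deg_ltD; first by apply: deg_ltZ; apply: deg_ltM.
  by apply: deg_ltW (linX _ _); lia.
have [C [D YCD]] := polyfun_aut_py a.
have [lY|gY] := leqP (size (normp W C D)) n.+1.
  have Y1 : deg_lt Y n.+1 by exists C, D.
  have := deg_ltM Y1 (deg_ltD Y1 (linX (wa1 W) (wa3 W))).
  move=> /(deg_lt_eq E) /(deg_ltW (n := (n + n + n)%N)) L3.
  by case: (deg_lt_has_deg closedF R3); apply: L3; lia.
have Ym : has_deg Y (size (normp W C D)).-1.
  by exists C, D; split=> //; rewrite prednK // (leq_trans _ gY).
set m := _.-1 in Ym; have {gY} gY : (n < m)%N by rewrite /m; lia.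
have := has_degM Ym (has_degD Ym (deg_ltW gY (linX (wa1 W) (wa3 W)))).
move=> /(has_deg_eq E) /(has_deg_inj closedF R3) nm.
exists (m - n).-1; split.
  by rewrite (_ : 2 * _ = n)%N //; lia.
by rewrite (_ : 3 * _ = m)%N //; lia.
Qed.

End RegularFunctions.

(** * Automorphisms are affine substitutions *)

(** The usual transformation formulas for the coefficients of a Weierstrass
    equation, when the new coefficients are equal to the old ones. *)
Record substitution (F : fieldType) (W : weierstrass F) (u r s t : F) : Prop :=
  Substitution {
    subst_u : u != 0;
    subst_a1 : u * wa1 W = wa1 W + 2 * s;
    subst_a2 : u ^+ 2 * wa2 W = wa2 W - s * wa1 W + 3 * r - s ^+ 2;
    subst_a3 : u ^+ 3 * wa3 W = wa3 W + r * wa1 W + 2 * t;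
    subst_a4 : u ^+ 4 * wa4 W = wa4 W - s * wa3 W + 2 * r * wa2 W
      - (t + r * s) * wa1 W + 3 * r ^+ 2 - 2 * s * t;
    subst_a6 : u ^+ 6 * wa6 W = wa6 W + r * wa4 W + r ^+ 2 * wa2 W + r ^+ 3
      - t * wa3 W - t ^+ 2 - r * t * wa1 W }.

Definition acts_as (F : fieldType) (W : weierstrass F)
    (phi : Defs.point W -> Defs.point W) (u r s t : F) : Prop :=
  forall P, is_affine P -> px (phi P) = u ^+ 2 * px P + r /\
    py (phi P) = u ^+ 3 * py P + u ^+ 2 * s * px P + t.

Section Structure.
Variables (F : fieldType) (W : weierstrass F).
Hypothesis closedF : alg_closed F.

Lemma size2_poly (A : {poly F}) : (size A <= 2)%N -> A = A`_1 *: 'X + (A`_0)%:P.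
Proof.
move=> sA; apply/polyP => -[|[|i]]; rewrite coefD coefZ coefX coefC /=.
- by rewrite mulr0 add0r.
- by rewrite mulr1 addr0.
by rewrite mulr0 addr0 nth_default // (leq_trans sA).
Qed.

(** The functions [1, x, x^2, x^3, y, x y] are linearly independent. *)
Lemma cubic_relation (c3 c2 c1 c0 e1 e0 : F) :
  (forall P : Defs.point W, is_affine P -> c3 * px P ^+ 3 + c2 * px P ^+ 2
     + c1 * px P + c0 + (e1 * px P + e0) * py P = 0) ->
  [/\ c3 = 0, c2 = 0, c1 = 0 & [/\ c0 = 0, e1 = 0 & e0 = 0]].
Proof.
move=> h0; have [] := @represents0 F W closedF
  (c3 *: 'X^3 + c2 *: 'X^2 + c1 *: 'X + c0%:P) (e1 *: 'X + e0%:P).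
  by move=> P aP; rewrite !hornerDE h0.
move=> /polyP A0 /polyP B0; move: (A0 3) (A0 2) (A0 1) (A0 0) (B0 1) (B0 0).
rewrite !(coefD, coefZ, coefXn, coefX, coefC, coef0) /=.
by rewrite !(mulr0, mulr1, addr0, add0r).
Qed.

(** Composing [a] with its inverse gives [d'.+1 * (2 * d.+1) = 2] for the factors
    by which they multiply the pole orders.  So [px (a P)] and [py (a P)] have
    poles of order 2 and 3, hence are affine in [x] and in [x, y], and
    substituting them in the equation gives [ga ^+ 2 = al ^+ 3] for the leading
    coefficients; then [u = ga / al]. *)
Lemma aut_acts_as (a : curveAut W) :
  exists u r s t, substitution W u r s t /\ acts_as a u r s t.
Proof.
have [d [Xd Yd]] := aut_has_deg closedF a.
have [d' [Xd' Yd']] := aut_has_deg closedF (aut_opp a).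
have {d' Xd' Yd'} d0 : d = 0%N.
  have [A [B [XAB sAB]]] := Xd.
  have := has_deg_comp Xd' Yd' sAB.
  move=> /(has_deg_eq (k := @px F W)) deg2.
  have : (d'.+1 * (2 * d.+1) = 2)%N.
    apply: (has_deg_inj closedF) (has_deg_px W); apply: deg2 => P aP.
    by rewrite -XAB ?aut_affine // aut_oppK.
  nia.
rewrite {}d0 in Xd Yd.
have [be [al [al0 Xa]]] : exists be al, al != 0 /\
    forall P, is_affine P -> px (a P) = al * px P + be.
  have [A [B [XAB +]]] := Xd; rewrite size_normp.
  have [B0|B0] := eqVneq B 0; last first.
    by have : (0 < size B)%N by [rewrite size_poly_gt0]; lia.
  move=> sA; have {}sA : size A = 2%N by lia.
  exists A`_0, A`_1; split.
    by have := lead_coef_eq0 A; rewrite lead_coefE sA -size_poly_eq0 sA => ->.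
  move=> P aP; rewrite XAB // B0 [A]size2_poly ?sA // !coefE /= !hornerDE.
  by ring.
have [ga [de [ep [ga0 Ya]]]] : exists ga de ep, ga != 0 /\
    forall P, is_affine P -> py (a P) = ga * py P + de * px P + ep.
  have [A [B [YAB +]]] := Yd; rewrite size_normp.
  have [_|B0 sAB] := eqVneq B 0; first lia.
  have /size1_polyC BE : (size B <= 1)%N by lia.
  exists B`_0, A`_1, A`_0; split.
    by move: B0; rewrite {1}BE polyC_eq0.
  move=> P aP; rewrite YAB // BE [A]size2_poly; last by lia.
  by rewrite !coefE /= !hornerDE; ring.

have : forall P : Defs.point W, is_affine P ->
   (ga ^+ 2 - al ^+ 3) * px P ^+ 3 +
   (ga ^+ 2 * wa2 W + de ^+ 2 + wa1 W * al * de - 3 * al ^+ 2 * be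
      - wa2 W * al ^+ 2) * px P ^+ 2 +
   (ga ^+ 2 * wa4 W + 2 * de * ep + wa1 W * al * ep + wa1 W * be * de
      + wa3 W * de - 3 * al * be ^+ 2 - 2 * wa2 W * al * be - wa4 W * al) * px P +
   (ga ^+ 2 * wa6 W + ep ^+ 2 + wa1 W * be * ep + wa3 W * ep - be ^+ 3
      - wa2 W * be ^+ 2 - wa4 W * be - wa6 W) +
   (ga * (2 * de - ga * wa1 W + wa1 W * al) * px P +
    ga * (2 * ep - ga * wa3 W + wa1 W * be + wa3 W)) * py P = 0.
  move=> P aP; have e := curve_eq aP; have := curve_eq (aut_affine a aP).
  rewrite Xa // Ya // !wcubE !wlinE in e * => /eqP.
  rewrite -subr_eq0 => /eqP e'.
  by rewrite -[RHS]e'; ring: e.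
move=> /cubic_relation[/eqP + e2 e4 [e6 /eqP + /eqP +]].
rewrite subr_eq0 !mulf_eq0 (negPf ga0) /= => /eqP g2 /eqP e1 /eqP e3.
pose u := ga / al.
have u0 : u != 0 by rewrite mulf_neq0 ?invr_eq0.
have alE : al = u ^+ 2 by rewrite /u expr_div_n g2 exprS mulfK ?expf_neq0.
have gaE : ga = u ^+ 3 by rewrite exprSr -alE /u mulrC divfK.
pose s := de / u ^+ 2.
have deE : de = u ^+ 2 * s by rewrite /s mulrC divfK ?expf_neq0.
exists u, be, s, ep; split; last first.
  by move=> P aP; rewrite Xa // Ya // -alE -gaE alE -deE.
have cancel n x : u ^+ n * x = 0 -> x = 0.
  by move=> /eqP; rewrite mulf_eq0 expf_eq0 (negPf u0) andbF => /eqP.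
split=> //; apply/eqP; rewrite -subr_eq0; apply/eqP.
- by apply: (cancel 2); rewrite -[RHS]oppr0 -[in RHS]e1 alE gaE deE; ring.
- by apply: (cancel 4); rewrite -[RHS]e2 alE gaE deE; ring.
- by rewrite -[RHS]oppr0 -[in RHS]e3 gaE; ring.
- by apply: (cancel 2); rewrite -[RHS]e4 alE gaE deE; ring.
- by rewrite -[RHS]e6 gaE; ring.
Qed.

End Structure.

(** * The invariants c4 and c6 *)

Section Invariants.
Variables (F : fieldType) (W : weierstrass F).

Definition wc6 : F := - wb2 W ^+ 3 + 36 * wb2 W * wb4 W - 216 * wb6 W.

Lemma c4_c6_disc : 1728 * wdisc W = wc4 W ^+ 3 - wc6 ^+ 2.
Proof. by rewrite /wdisc /wc4 /wc6 /wb2 /wb4 /wb6 /wb8; ring. Qed.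

Variables u r s t : F.
Hypothesis subst_W : substitution W u r s t.

Lemma subst_c4 : u ^+ 4 * wc4 W = wc4 W.
Proof.
case: subst_W => _ e1 e2 e3 e4 _.
have -> : u ^+ 4 * wc4 W = ((u * wa1 W) ^+ 2 + 4 * (u ^+ 2 * wa2 W)) ^+ 2
    - 24 * (2 * (u ^+ 4 * wa4 W) + u * wa1 W * (u ^+ 3 * wa3 W)).
  by rewrite /wc4 /wb2 /wb4; ring.
by rewrite e1 e2 e3 e4 /wc4 /wb2 /wb4; ring.
Qed.

Lemma subst_c6 : u ^+ 6 * wc6 = wc6.
Proof.
case: subst_W => _ e1 e2 e3 e4 e6.
pose b2 := (u * wa1 W) ^+ 2 + 4 * (u ^+ 2 * wa2 W).
pose b4 := 2 * (u ^+ 4 * wa4 W) + u * wa1 W * (u ^+ 3 * wa3 W).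
pose b6 := (u ^+ 3 * wa3 W) ^+ 2 + 4 * (u ^+ 6 * wa6 W).
have -> : u ^+ 6 * wc6 = - b2 ^+ 3 + 36 * b2 * b4 - 216 * b6.
  by rewrite /wc6 /wb2 /wb4 /wb6 /b2 /b4 /b6; ring.
by rewrite /b2 /b4 /b6 e1 e2 e3 e4 e6 /wc6 /wb2 /wb4 /wb6; ring.
Qed.

Lemma on_curve_subst x y :
  on_curve W (u ^+ 2 * x + r) (u ^+ 3 * y + u ^+ 2 * s * x + t) = on_curve W x y.
Proof.
case: subst_W => u0 e1 e2 e3 e4 e6.
rewrite /on_curve -subr_eq0 -[RHS]subr_eq0.
have u6 (z : F) : (z == 0) = (u ^+ 6 * z == 0).
  by rewrite mulf_eq0 expf_eq0 (negPf u0).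
rewrite [RHS]u6; congr (_ == 0).
pose X := u ^+ 2 * x; pose Y := u ^+ 3 * y.
transitivity (Y ^+ 2 + (u * wa1 W) * X * Y + (u ^+ 3 * wa3 W) * Y
   - (X ^+ 3 + (u ^+ 2 * wa2 W) * X ^+ 2 + (u ^+ 4 * wa4 W) * X + u ^+ 6 * wa6 W)).
  by rewrite e1 e2 e3 e4 e6 /X /Y; ring.
by rewrite /X /Y; ring.
Qed.

End Invariants.

(** * The group law on substitutions *)

Section Substitutions.
Variables (F : fieldType) (W : weierstrass F).
Implicit Types (P Q : Defs.point W) (a b : curveAut W).

Lemma affine_point_eq P Q : is_affine P -> is_affine Q ->
  px P = px Q -> py P = py Q -> P = Q.
Proof. by case: P Q => // x y e [] // x' y' e' _ _; apply: affine_eq. Qed.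

Lemma acts_as_eq a b u r s t :
  acts_as a u r s t -> acts_as b u r s t -> a = b.
Proof.
move=> aE bE; apply: curveAutP => P.
have [aP|] := boolP (is_affine P); last by case: P => // _; rewrite !aut_origin.
have [ax ay] := aE P aP; have [bx b_y] := bE P aP.
by apply: affine_point_eq; rewrite ?aut_affine // ?ax ?bx ?ay ?b_y.
Qed.

Lemma acts_as_mul a b u r s t u' r' s' t' :
  acts_as a u r s t -> acts_as b u' r' s' t' ->
  acts_as (a * b)%g (u * u') (u ^+ 2 * r' + r) (u * s' + s)
    (u ^+ 3 * t' + u ^+ 2 * s * r' + t).
Proof.
move=> aE bE P aP; have [bx b_y] := bE P aP.
have [/= -> ->] := aE (b P) (aut_affine b aP).
by rewrite bx b_y; split; ring.
Qed.

Lemma acts_as_neg : acts_as (aut_neg W) (-1) 0 (- wa1 W) (- wa3 W).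
Proof. by case=> //= x y e _; split; ring. Qed.

Lemma acts_as_negM a u r s t : acts_as a u r s t ->
  acts_as (aut_neg W * a)%g (- u) r (- s - wa1 W) (- t - wa1 W * r - wa3 W).
Proof.
move=> /(acts_as_mul acts_as_neg) h P aP.
by have [-> ->] := h P aP; split; ring.
Qed.

Lemma regular_affine (phi : Defs.point W -> Defs.point W) (al be ga de ep : F) :
  ga != 0 -> phi Origin = Origin ->
  (forall P, is_affine P -> [/\ is_affine (phi P), px (phi P) = al * px P + be
     & py (phi P) = ga * py P + de * px P + ep]) ->
  regular phi.
Proof.
move=> ga0 phi0 phiE.
pose o k (h : (k < 3)%N) := Ordinal h.
pose X k (h : (k < 3)%N) : {mpoly F[3]} := 'X_(o k h).
pose f : 'I_3 -> {mpoly F[3]} := tnth [tuple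
  al *: X 0%N isT + be *: X 2%N isT;
  ga *: X 1%N isT + de *: X 0%N isT + ep *: X 2%N isT; X 2%N isT].
have ind (T : 'I_3 -> Prop) :
    T (o 0%N isT) -> T (o 1%N isT) -> T (o 2%N isT) -> forall i, T i.
  move=> t0 t1 t2 [[|[|[|//]]] h].
  - by rewrite (_ : Ordinal h = o 0%N isT) //; exact: val_inj.
  - by rewrite (_ : Ordinal h = o 1%N isT) //; exact: val_inj.
  - by rewrite (_ : Ordinal h = o 2%N isT) //; exact: val_inj.
have f0 v : (f (o 0%N isT)).@[v] = al * v (o 0%N isT) + be * v (o 2%N isT).
  by rewrite /f /tnth /= mevalD !mevalZ !mevalXU.
have f1 v : (f (o 1%N isT)).@[v] =
    ga * v (o 1%N isT) + de * v (o 0%N isT) + ep * v (o 2%N isT).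
  by rewrite /f /tnth /= !mevalD !mevalZ !mevalXU.
have f2 v : (f (o 2%N isT)).@[v] = v (o 2%N isT) by exact: mevalXU.
have hX i : 'X_i \is [in F[3], 1.-homog] by rewrite dhomogX /= mdeg1.
move=> P; exists 1%N, f; split.
- apply: ind; rewrite /f /tnth /=; last exact: hX.
  - by rewrite rpredD // rpredZ // hX.
  - by rewrite !rpredD // rpredZ // hX.
- case: P => [|x y h].
    by exists (o 1%N isT); rewrite f1 /hcoord /tnth /= mulr1 !mulr0 !addr0.
  by exists (o 2%N isT); rewrite f2 /= oner_neq0.
- move=> [|x y h] _.
    exists ga => //; rewrite phi0.
    by apply: ind; rewrite ?f0 ?f1 ?f2 /hcoord /tnth /=; ring.
  exists 1; first exact: oner_neq0.
  have [] := phiE (Affine h) isT; case: (phi _) => // x' y' h' _ /= -> ->.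
  by apply: ind; rewrite ?f0 ?f1 ?f2 /hcoord /tnth /=; ring.
Qed.

Definition affine_map (f : F -> F) (g : F -> F -> F)
    (fgW : forall x y, on_curve W x y -> on_curve W (f x) (g x y)) P : Defs.point W :=
  match P with
  | Origin => Origin
  | Affine x y h => Affine (fgW x y h)
  end.

Lemma substitution_aut u r s t : substitution W u r s t ->
  exists a, acts_as a u r s t.
Proof.
move=> sW; have u0 := subst_u sW.
have fW x y : on_curve W x y ->
    on_curve W (u ^+ 2 * x + r) (u ^+ 3 * y + u ^+ 2 * s * x + t).
  by rewrite on_curve_subst.
have gW x y : on_curve W x y -> on_curve W (u ^- 2 * x - u ^- 2 * r)
   (u ^- 3 * y + (- (u ^- 3 * s)) * x + u ^- 3 * (s * r - t)).
  move=> h; rewrite -(on_curve_subst sW).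
  have -> : u ^+ 2 * (u ^- 2 * x - u ^- 2 * r) + r = x by field.
  set z := (z in on_curve _ _ z); suff -> : z = y by [].
  by rewrite /z; field.
have fK : cancel (affine_map fW) (affine_map gW).
  by case=> //= x y h; apply: affine_eq; field.
have gK : cancel (affine_map gW) (affine_map fW).
  by case=> //= x y h; apply: affine_eq; field.
have rf : regular (affine_map fW).
  apply: (@regular_affine _ (u ^+ 2) r (u ^+ 3) (u ^+ 2 * s) t) => //.
    exact: expf_neq0.
  by case.
have rg : regular (affine_map gW).
  apply: (@regular_affine _ (u ^- 2) (- (u ^- 2 * r)) (u ^- 3)
    (- (u ^- 3 * s)) (u ^- 3 * (s * r - t))) => //.
    by rewrite invr_eq0 expf_neq0.
  by case.
by exists (CurveAut fK gK rf rg erefl); case.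
Qed.

Hypothesis closedF : alg_closed F.

Lemma acts_as_inj a u r s t u' r' s' t' : u != 0 -> u' != 0 ->
  acts_as a u r s t -> acts_as a u' r' s' t' ->
  [/\ u = u', r = r', s = s' & t = t'].
Proof.
move=> u0 u'0 aE aE'.
(* The trivial equations are the vanishing coefficients of x^3, x^2, y, x y. *)
have [_ _ /eqP + [/eqP + _ _]] : [/\ (0 : F) = 0, (0 : F) = 0,
    u ^+ 2 - u' ^+ 2 = 0
    & [/\ r - r' = 0, (0 : F) = 0 & (0 : F) = 0]].
  apply: (cubic_relation (W := W)) => // P aP.
  have [e _] := aE P aP; have [+ _] := aE' P aP; rewrite e => /eqP.
  by rewrite -subr_eq0 => /eqP e'; rewrite -[RHS]e'; ring.
rewrite !subr_eq0 => /eqP u2 /eqP rr.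
have [_ _ /eqP e1 [/eqP e2 _ /eqP e3]] : [/\ (0 : F) = 0, (0 : F) = 0,
    u ^+ 2 * s - u' ^+ 2 * s' = 0
    & [/\ t - t' = 0, (0 : F) = 0 & u ^+ 3 - u' ^+ 3 = 0]].
  apply: (cubic_relation (W := W)) => // P aP.
  have [_ e] := aE P aP; have [_ +] := aE' P aP; rewrite e => /eqP.
  by rewrite -subr_eq0 => /eqP e'; rewrite -[RHS]e'; ring.
move: e1 e2 e3; rewrite !subr_eq0 -u2 ![_ ^+ 3]exprS -u2.
rewrite (inj_eq (mulfI (expf_neq0 2 u0))) (inj_eq (mulIf (expf_neq0 2 u0))).
by move=> /eqP -> /eqP -> /eqP ->.
Qed.

End Substitutions.

(** * Supersingular curves in characteristics 2 and 3 *)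

Section Commuting.
Variables (F : fieldType) (W : weierstrass F).
Hypothesis closedF : alg_closed F.
Hypothesis abelianW : forall a b : curveAut W, (a * b = b * a)%g.

Lemma substitution_comm u r s t u' r' s' t' :
  substitution W u r s t -> substitution W u' r' s' t' ->
  u ^+ 2 * r' + r = u' ^+ 2 * r + r' /\
  u ^+ 3 * t' + u ^+ 2 * s * r' + t = u' ^+ 3 * t + u' ^+ 2 * s' * r + t'.
Proof.
move=> sW sW'; have [u0 u'0] := (subst_u sW, subst_u sW').
have [a aE] := substitution_aut sW; have [b bE] := substitution_aut sW'.
have := acts_as_mul bE aE; rewrite abelianW => baE.
by have [] := acts_as_inj closedF (mulf_neq0 u0 u'0) (mulf_neq0 u'0 u0)
  (acts_as_mul aE bE) baE.
Qed.

(** In characteristic 3 with [b2 = 0], the translation by [d] in the direction of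
    [x] preserves the curve when [d ^+ 2 = b4]. It commutes with the
    substitution of parameter [u] only if [u ^+ 2 * d = d]. *)
Lemma char3_supersingular u r s t : substitution W u r s t ->
  3 = 0 :> F -> wb2 W = 0 -> wdisc W != 0 -> u ^+ 2 = 1.
Proof.
move=> sW h3 b20 disc0.
have b40 : wb4 W != 0.
  apply: contraNneq disc0 => b40; apply/eqP.
  by rewrite -(mul0r (- 9 * wb6 W ^+ 2)) -h3 /wdisc b20 b40; ring.
have [d d2] := alg_closed_quadratic 0 (wb4 W) closedF.
rewrite mul0r add0r in d2.
have d0 : d != 0.
  by apply: contraNneq b40 => d0; rewrite -d2 d0 expr0n.
(* The last parameter solves 2 * t = - d * a1, as 2 = -1. *)
have tauW : substitution W 1 d 0 (d * wa1 W).
  split; first exact: oner_neq0.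
  - by ring.
  - by rewrite h3; ring.
  - by rewrite -[LHS]addr0 -(mul0r (d * wa1 W)) -h3; ring.
  - transitivity (wa4 W + 3 * (2 * d * wa2 W) + 3 * d ^+ 2 - d * wb2 W).
      by rewrite b20 h3; ring.
    by rewrite /wb2; ring.
  - transitivity (wa6 W + d * (d ^+ 2 - wb4 W) + d ^+ 2 * wb2 W
        + 3 * (d * wa4 W - d ^+ 2 * wa2 W - d ^+ 2 * wa1 W ^+ 2)).
      by rewrite d2 subrr b20 h3; ring.
    by rewrite /wb2 /wb4; ring.
have [e _] := substitution_comm sW tauW.
move: e; rewrite expr1n mul1r addrC => /addrI e.
by apply: (mulIf d0); rewrite mul1r.
Qed.

(** In characteristic 2 with [a1 = 0], every [s] such that [s ^+ 3 = a3] gives an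
    automorphism with parameters [1, s ^+ 2, s, t]. Those of [s] and [s'] commute
    only if [s * s' ^+ 2 = s' * s ^+ 2], which fails for [s' = w * s] with [w] a
    primitive cube root of unity. *)
Lemma char2_supersingular :
  2 = 0 :> F -> wa1 W = 0 -> wdisc W != 0 -> False.
Proof.
move=> h2 a10 disc0.
have a30 : wa3 W != 0.
  apply: contraNneq disc0 => a30; apply/eqP.
  have h4 : 4 = 0 :> F by transitivity (2 * 2 : F); [ring | rewrite h2 mul0r].
  by rewrite /wdisc /wb2 /wb4 /wb6 a10 a30 h4 h2; ring.
have subst_s s : s ^+ 3 = wa3 W -> exists t, substitution W 1 (s ^+ 2) s t.
  move=> s3; pose c := s ^+ 2 * wa4 W + s ^+ 4 * wa2 W + s ^+ 6.
  have [t t2] := alg_closed_quadratic (- wa3 W) c closedF.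
  exists t; split; first exact: oner_neq0.
  - by rewrite h2; ring.
  - by rewrite -[LHS]addr0 -(mul0r (s ^+ 2)) -h2 a10; ring.
  - by rewrite a10 h2; ring.
  - by rewrite -s3 -[LHS]addr0 -(mul0r (s ^+ 4 + s ^+ 2 * wa2 W - s * t)) -h2 a10; ring.
  - by rewrite a10 t2 /c; ring.
have [s] : exists s, s ^+ 3 = (wa3 W)%:P.[s].
  apply: alg_closed_monic => //; exact: leq_trans (size_polyC_leq1 _) _.
rewrite hornerC => s3.
have [w w2] := alg_closed_quadratic (-1) (-1) closedF.
have ws3 : (w * s) ^+ 3 = wa3 W.
  rewrite exprMn s3 (_ : w ^+ 3 = 1) ?mul1r // exprS w2 mulrDr mulrN1 mulrCA.
  by rewrite -expr2 w2; ring.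
have [t sW] := subst_s _ s3; have [t' sW'] := subst_s _ ws3.
have [_ e] := substitution_comm sW sW'.
have s0 : s != 0 by apply: contraNneq a30 => s0; rewrite -s3 s0 expr0n.
have w0 : w != 0.
  by apply/eqP => w0; move/eqP: ws3; rewrite w0 mul0r expr0n eq_sym (negPf a30).
have /eqP : s ^+ 3 * w * (w - 1) = 0.
  move/eqP: e; rewrite -subr_eq0 => /eqP e; rewrite -[RHS]e; ring.
rewrite !mulf_eq0 (negPf s0) (negPf w0) /= subr_eq0 => /eqP w1.
move/eqP: w2; rewrite w1 -subr_eq0 => /eqP e2.
have /eqP := oner_neq0 F; apply.
transitivity (3 - 2 : F); first by ring.
by rewrite h2 subr0 -[RHS]e2; ring.
Qed.

End Commuting.

(** * Automorphisms which Galois changes by a sign *)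

Section Twist.
Variables (K L : fieldType) (iota : {rmorphism K -> L}) (E : ellipticCurve K).
Hypothesis closedL : alg_closed L.
Local Notation EL := (weierstrass_map iota E).
Implicit Types (a b : curveAut EL) (sigma : galGroup iota).

Lemma acts_as_gal sigma a u r s t : acts_as a u r s t ->
  acts_as (gal_aut sigma a) (sigma u) (sigma r) (sigma s) (sigma t).
Proof.
move=> aE P; rewrite -(gal_pointVK sigma P) /= /gal_map gal_pointK.
set Q := gal_point _ P => aQ.
have pxE R : px (gal_point sigma R) = sigma (px R).
  by case: R => //=; rewrite rmorph0.
have pyE R : py (gal_point sigma R) = sigma (py R).
  by case: R => //=; rewrite rmorph0.
have {}aQ : is_affine Q by case: Q aQ.
have [ax ay] := aE Q aQ.
by rewrite !pxE !pyE ax ay !(rmorphXn, rmorphM, rmorphD).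
Qed.

Lemma wdisc_map : wdisc EL = iota (wdisc E).
Proof.
rewrite /wdisc /wb2 /wb4 /wb6 /wb8 /=.
by rewrite !(rmorph_nat, rmorphXn, rmorphM, rmorphN, rmorphD).
Qed.

Lemma wc6_map : wc6 EL = iota (wc6 E).
Proof.
rewrite /wc6 /wb2 /wb4 /wb6 /=.
by rewrite !(rmorph_nat, rmorphXn, rmorphM, rmorphN, rmorphD).
Qed.

Lemma wdisc_map_neq0 : wdisc EL != 0.
Proof. by rewrite wdisc_map fmorph_eq0 ec_smooth. Qed.

Lemma twist_subst sigma a u r s t :
  substitution EL u r s t -> acts_as a u r s t ->
  gal_aut sigma a = (aut_neg EL * a)%g ->
  [/\ sigma u = - u, sigma r = r, sigma s = - s - wa1 EL
    & sigma t = - t - wa1 EL * r - wa3 EL].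
Proof.
move=> sW aE twist; have u0 := subst_u sW.
have := acts_as_gal sigma aE; rewrite twist => h.
apply: (acts_as_inj closedL _ _ h (acts_as_negM aE)).
  by rewrite fmorph_eq0.
by rewrite oppr_eq0.
Qed.

(** If [c6] is nonzero then [u ^+ 6 = 1], so that [u ^+ 3] is 1 or -1 and is fixed
    by [sigma], whereas [sigma u = - u] gives [sigma (u ^+ 3) = - u ^+ 3]. *)
Lemma twist_c6 sigma a : 2 != 0 :> L ->
  gal_aut sigma a = (aut_neg EL * a)%g -> wc6 EL = 0.
Proof.
move=> h2 twist; have [u [r [s [t [sW aE]]]]] := aut_acts_as closedL a.
have [su _ _ _] := twist_subst sW aE twist; have u0 := subst_u sW.
apply/eqP; apply: contraT => c60.
have : u ^+ 6 == 1 by apply/eqP/(mulIf c60); rewrite mul1r; exact: subst_c6 sW.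
rewrite (exprM u 3 2) sqrf_eq1 => /orP u3.
have : sigma (u ^+ 3) = u ^+ 3.
  by case: u3 => /eqP ->; rewrite ?rmorphN rmorph1.
rewrite rmorphXn /= su => /eqP; rewrite -subr_eq0 => /eqP e.
have /eqP : 2 * u ^+ 3 = 0 by rewrite -oppr0 -[in RHS]e; ring.
by rewrite mulf_eq0 expf_eq0 (negPf h2) (negPf u0).
Qed.

(** With [3 = 0], [c6 = 0] implies [c4 = 0] and [b2 = 0]; then commutation with the
    translation of [char3_supersingular] gives [u = 1] or [u = -1], contradicting
    [sigma u = - u]. *)
Lemma twist_char3 sigma a :
  (forall a b : curveAut EL, (a * b = b * a)%g) -> 2 != 0 :> L ->
  gal_aut sigma a = (aut_neg EL * a)%g -> 3 != 0 :> L.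
Proof.
move=> abel h2 twist; apply/eqP => h3.
have [u [r [s [t [sW aE]]]]] := aut_acts_as closedL a.
have [su _ _ _] := twist_subst sW aE twist; have u0 := subst_u sW.
have c60 := twist_c6 h2 twist.
have /eqP : wc4 EL ^+ 3 = 0.
  have := c4_c6_disc EL; rewrite c60 (_ : 1728 = 3 * 576); last by ring.
  by rewrite h3 !mul0r expr0n subr0.
rewrite expf_eq0 /= /wc4 (_ : 24 = 3 * 8); last by ring.
rewrite h3 !mul0r subr0 expf_eq0 /= => /eqP b20.
have := char3_supersingular closedL abel sW h3 b20 wdisc_map_neq0.
move/eqP; rewrite sqrf_eq1 => /orP u1.
have : sigma u = u by case: u1 => /eqP ->; rewrite ?rmorphN rmorph1.
rewrite su => /eqP; rewrite -subr_eq0 => /eqP e.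
have /eqP : 2 * u = 0 by rewrite -oppr0 -[in RHS]e; ring.
by rewrite mulf_eq0 (negPf h2) (negPf u0).
Qed.

(** With [2 = 0] and [a1 <> 0], the transformation formulas give [u = 1], [r = 0],
    [s = 0] or [s = a1], and [t] in terms of [s]; all of these are fixed by
    [sigma], and so is [a]. *)
Lemma twist_char2 sigma a :
  (forall a b : curveAut EL, (a * b = b * a)%g) ->
  gal_aut sigma a = (aut_neg EL * a)%g -> gal_aut sigma a <> a -> 2 != 0 :> L.
Proof.
move=> abel twist na; apply/eqP => h2.
have [u [r [s [t [sW aE]]]]] := aut_acts_as closedL a.
have [su sr ss st] := twist_subst sW aE twist.
have [a10|a10] := eqVneq (wa1 EL) 0.
  exact: char2_supersingular closedL abel h2 a10 wdisc_map_neq0.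
have [u0 e1 e2 e3 e4 e6] := sW.
have u1 : u = 1 by apply: (mulIf a10); rewrite e1 h2 mul0r addr0 mul1r.
have r0 : r = 0.
  apply: (mulIf a10); move: e3; rewrite u1 expr1n mul1r h2 !mul0r addr0 => /eqP.
  by rewrite -subr_eq0 opprD addNKr oppr_eq0 => /eqP.
have s2 : s * (s + wa1 EL) = 0.
  move: e2; rewrite u1 r0 => /eqP; rewrite -subr_eq0 => /eqP e.
  by rewrite -[RHS]e; ring.
have tE : t = - (s * wa3 EL / wa1 EL).
  apply: (mulIf a10); rewrite mulNr divfK //.
  move: e4; rewrite u1 r0 h2 => /eqP; rewrite -subr_eq0 => /eqP e.
  by apply/eqP; rewrite -subr_eq0; apply/eqP; rewrite -[RHS]e; ring.
have fix_s : sigma s = s.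
  move/eqP: s2; rewrite mulf_eq0 addr_eq0 => /orP[] /eqP ->.
    by rewrite rmorph0.
  by rewrite rmorphN /= gal_fix.
have fix_t : sigma t = t.
  by rewrite tE rmorphN !rmorphM fmorphV /= fix_s !gal_fix.
apply: na; apply: (acts_as_eq (acts_as_gal sigma aE)).
by rewrite sr fix_s fix_t (_ : sigma u = u) // u1 rmorph1.
Qed.

End Twist.

(** * The exceptional case *)

Lemma notin_pchar (F E : fieldType) (f : {rmorphism F -> E}) p :
  prime p -> (p \notin [pchar F]) = ((p%:R : E) != 0).
Proof. by move=> pp; rewrite inE pp /= -(rmorph_nat f) fmorph_eq0. Qed.

Lemma neg_predP (F : fieldType) (W : weierstrass F) (a : curveAut W) :
  neg_pred a -> a = 1%g \/ a = aut_neg W.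
Proof.
move=> /asboolP[n ->]; elim: n => [|n [] IH]; first by left; rewrite expg0.
  by right; rewrite expgS IH mulg1.
by left; rewrite expgS IH -{1}aut_negV mulVg.
Qed.

Lemma neg_pred_pair (F : fieldType) (W : weierstrass F) (a b : curveAut W) :
  neg_pred a -> neg_pred b -> b = a \/ b = (aut_neg W * a)%g.
Proof.
move=> /neg_predP[->|->] /neg_predP[->|->]; rewrite ?mulg1;
  [by left | by right | | by left].
by right; rewrite -{1}aut_negV mulVg.
Qed.

Section Exceptional.
Variables (K L : fieldType) (iota : {rmorphism K -> L}) (E : ellipticCurve K).
Hypothesis closedL : alg_closed L.
Local Notation EL := (weierstrass_map iota E).
Implicit Types (a b : curveAut EL) (sigma : galGroup iota).

Lemma jinv_1728 : 2 != 0 :> L -> 3 != 0 :> L ->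
  (jinv E = 12 ^+ 3 <-> wc6 EL = 0).
Proof.
move=> h2 h3; rewrite wc6_map /jinv; have d0 := ec_smooth E.
have e12 : 12 ^+ 3 = 1728 :> K by ring.
have := c4_c6_disc E; rewrite e12 => e.
split=> [j1728|/eqP].
  have : wc6 E ^+ 2 = 0.
    by rewrite -(subrr (wc4 E ^+ 3)) -{2}(divfK d0 (wc4 E ^+ 3)) j1728 e; ring.
  by move/eqP; rewrite expf_eq0 => /eqP ->; rewrite rmorph0.
rewrite fmorph_eq0 => /eqP c60; move: e; rewrite c60 expr0n subr0 => <-.
by rewrite mulfK.
Qed.

Lemma twist_exceptional sigma a :
  (forall a b : curveAut EL, (a * b = b * a)%g) ->
  gal_aut sigma a = (aut_neg EL * a)%g -> gal_aut sigma a <> a ->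
  [/\ 2%N \notin [pchar K], 3%N \notin [pchar K] & jinv E = 12 ^+ 3].
Proof.
move=> abel twist na; have h2 := twist_char2 closedL abel twist na.
have h3 := twist_char3 closedL abel h2 twist.
rewrite !(notin_pchar iota) //; split=> //.
exact/(jinv_1728 h2 h3)/(twist_c6 closedL h2 twist).
Qed.

Lemma acts_as_substitution a u r s t : u != 0 ->
  acts_as a u r s t -> substitution EL u r s t.
Proof.
move=> u0 aE; have [u' [r' [s' [t' [sW aE']]]]] := aut_acts_as closedL a.
by have [-> -> -> ->] := acts_as_inj closedL u0 (subst_u sW) aE aE'.
Qed.

Lemma substitution_inj u r s t r' s' t' : 2 != 0 :> L -> 3 != 0 :> L ->
  substitution EL u r s t -> substitution EL u r' s' t' ->
  [/\ r = r', s = s' & t = t'].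
Proof.
move=> h2 h3 [_ e1 e2 e3 _ _] [_ e1' e2' e3' _ _].
have ss : s = s' by apply: (mulfI h2); apply: (addrI (wa1 EL)); rewrite -e1.
have rr : r = r'.
  apply: (mulfI h3); apply: (addrI (wa2 EL - s * wa1 EL)).
  by apply: (addIr (- s ^+ 2)); rewrite -e2 e2' ss.
split=> //; apply: (mulfI h2).
by apply: (addrI (wa3 EL + r * wa1 EL)); rewrite -e3 e3' rr.
Qed.

Lemma aut_eq_u a b u r s t r' s' t' : 2 != 0 :> L -> 3 != 0 :> L -> u != 0 ->
  acts_as a u r s t -> acts_as b u r' s' t' -> a = b.
Proof.
move=> h2 h3 u0 aE bE; apply: (acts_as_eq aE).
by have [-> -> ->] := substitution_inj h2 h3 (acts_as_substitution u0 aE)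
  (acts_as_substitution u0 bE).
Qed.

(** Here [c4] is nonzero, so [u ^+ 4 = 1]; moreover [b] is determined by [u], which
    is thus not fixed by [sigma0].  Hence [u ^+ 2 = -1], and each [sigma] maps [u]
    to [u] or [- u]. *)
Lemma exceptional_twist sigma0 b : 2 != 0 :> L -> 3 != 0 :> L ->
  wc6 EL = 0 -> gal_aut sigma0 b <> b ->
  exists u : L, forall sigma,
    gal_aut sigma b = if sigma u == u then b else (aut_neg EL * b)%g.
Proof.
move=> h2 h3 c60 nb.
have [u [r [s [t [sW bE]]]]] := aut_acts_as closedL b.
have u0 := subst_u sW.
have c40 : wc4 EL != 0.
  have : 1728 * wdisc EL != 0.
    rewrite mulf_neq0 ?wdisc_map_neq0 //.
    rewrite (_ : 1728 = 2 ^+ 6 * 3 ^+ 3); last by ring.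
    by rewrite mulf_neq0 // expf_neq0.
  by apply: contraNneq => c40; rewrite c4_c6_disc c40 c60 !expr0n subr0.
have fixb sigma : sigma u = u -> gal_aut sigma b = b.
  move=> su; have := acts_as_gal sigma bE; rewrite su => h.
  exact: aut_eq_u h2 h3 u0 h bE.
have : u ^+ 4 == 1 by apply/eqP/(mulIf c40); rewrite mul1r; exact: subst_c4 sW.
rewrite (exprM u 2 2) sqrf_eq1 => /orP[|/eqP u2].
  rewrite sqrf_eq1 => /orP u1; case: nb; apply: fixb.
  by case: u1 => /eqP ->; rewrite ?rmorphN rmorph1.
exists u => sigma; case: eqP => [/fixb //|nu].
have /eqP : sigma u ^+ 2 = u ^+ 2 by rewrite -rmorphXn u2 rmorphN rmorph1.
rewrite eqf_sqr => /orP[/eqP //|/eqP su].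
have := acts_as_gal sigma bE; rewrite su => h.
by apply: (aut_eq_u h2 h3 _ h (acts_as_negM bE)); rewrite oppr_eq0.
Qed.

End Exceptional.

(** * Cohomology *)

Section Cohomology.
Variables (K L : fieldType) (iota : {rmorphism K -> L}) (E : weierstrass K).
Local Notation EL := (weierstrass_map iota E).
Hypothesis abel : forall a b : curveAut EL, (a * b = b * a)%g.

Lemma abelian_cancel (a g n x y : curveAut EL) :
  y = (a^-1 * x * g)%g -> y = (n * x)%g -> g = (n * a)%g.
Proof.
move=> -> e; apply: (@mulgI _ x); apply: (@mulgI _ a^-1%g).
by rewrite mulgA e [RHS]abel -!mulgA mulgV mulg1 [RHS]abel.
Qed.

Lemma gal_aut_neg_pred (sigma : galGroup iota) (a : curveAut EL) :
  neg_pred a -> gal_aut sigma a = a.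
Proof. by move=> /asboolP[n ->]; exact: gal_aut_negX. Qed.

(** If [c] and [d] become cohomologous through [a], then [d s = - c s] would mean
    [s(a) = - a]. *)
Lemma neg_incl_injective :
  (forall (sigma : galGroup iota) (a : curveAut EL),
     gal_aut sigma a = (aut_neg EL * a)%g -> gal_aut sigma a = a) ->
  injective (H1_map (neg_incl iota E)).
Proof.
move=> untwisted; elim/quotW => c; elim/quotW => d.
rewrite !H1_map_pi => /eqmodP /asboolP[a cda]; apply/eqmodP/asboolP.
have cdE s : val (d s) = val (c s).
  have {cda} := cda s; rewrite /= => cda.
  have [//|dc] := neg_pred_pair (valP (c s)) (valP (d s)).
  have /untwisted ga : gal_aut s a = (aut_neg EL * a)%g.
    by apply: abelian_cancel cda _; rewrite dc.
  by move: cda; rewrite ga => ->; rewrite [LHS]abel mulgA mulgV mul1g.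
exists 1%g => s; apply: val_inj.
rewrite /= [gal_aut s 1%g](@gm_act_1 _ _ _ (autModule iota E)).
by rewrite invg1 mul1g mulg1 cdE.
Qed.

(** The coboundary of [b] in the automorphism group takes values in [<-1>], where
    it is not a coboundary because Galois acts trivially there.  It only depends
    on the image of [u], hence is continuous. *)
Lemma neg_incl_not_injective (sigma0 : galGroup iota) (b : curveAut EL) (u : L) :
  (forall sigma : galGroup iota,
     gal_aut sigma b = if sigma u == u then b else (aut_neg EL * b)%g) ->
  gal_aut sigma0 b <> b -> ~ injective (H1_map (neg_incl iota E)).
Proof.
move=> bE nb inj.
have neg_d sigma : neg_pred (b^-1 * gal_aut sigma b)%g.
  rewrite bE; apply/asboolP; case: ifP => _; first by exists 0%N; rewrite mulVg.
  by exists 1%N; rewrite [LHS]abel mulgK expg1.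
pose f sigma : negModule iota E := Sub _ (neg_d sigma).
have f_cont : continuous
    (f : galGroup iota -> discrete_topology (negModule iota E)).
  move=> sigma U; rewrite nbhs_principalE => /principal_filterP Uf.
  pose V : set (galGroup iota) := fun tau => tau u = sigma u.
  have oV : open V.
    by move=> tau tu; exists [:: u] => rho h; rewrite /V h ?inE.
  apply: filterS (open_nbhs_nbhs (conj oV (erefl (sigma u)))) => tau /= tu.
  suff -> : f tau = f sigma by [].
  by apply: val_inj; rewrite /= !bE tu.
have f_eq sigma tau : f (sigma * tau)%g = (f sigma * gm_act sigma (f tau))%g.
  apply: val_inj; rewrite /= gal_autA gal_autM.
  have -> : gal_aut sigma b^-1%g = (gal_aut sigma b)^-1%g.
    exact: (@gm_actV _ _ _ (autModule iota E)).
  by rewrite -mulgA mulVKg.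
have one_cont : continuous
    ((fun=> 1%g) : galGroup iota -> discrete_topology (negModule iota E)).
  exact: cst_continuous.
have one_eq (sigma tau : galGroup iota) :
    (1 : negModule iota E)%g = (1 * gm_act sigma 1)%g.
  by rewrite gm_act_1 mulg1.
pose d := Cocycle f_cont f_eq; pose c := Cocycle one_cont one_eq.
have /inj/eqmodP/asboolP[e ce] : H1_map (neg_incl iota E) (\pi_(H1 _) c)%qT
    = H1_map (neg_incl iota E) (\pi_(H1 _) d)%qT.
  rewrite !H1_map_pi; apply/eqmodP/asboolP; exists b => sigma /=.
  by rewrite mulg1.
apply: nb; apply: (@mulgI _ b^-1%g).
have /(congr1 val) /= -> := ce sigma0.
by rewrite (gal_aut_neg_pred _ (valP e)) mulg1 !mulVg.
Qed.

End Cohomology.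

Theorem proposition4p1 (K L : fieldType) (iota : {rmorphism K -> L})
    (E : ellipticCurve K) :
  perfect_field K ->
  is_separable_closure iota ->
  (forall a b : curveAut (weierstrass_map iota E), (a * b = b * a)%g) ->
  let exceptional :=
    [/\ 2%N \notin [pchar K], 3%N \notin [pchar K], jinv E = 12 ^+ 3 &
        exists (s : galGroup iota) (a : curveAut (weierstrass_map iota E)),
          gal_aut s a <> a] in
  (~ exceptional -> injective (H1_map (neg_incl iota E))) /\
  (exceptional -> ~ injective (H1_map (neg_incl iota E))).
Proof.
move=> perfK sepL abel exceptional.
have closedL := separable_closure_alg_closed perfK sepL.
split=> [not_exc|[]].
  apply: neg_incl_injective => // sigma a twist.
  apply: contrapT => na; apply: not_exc.
  have [] := twist_exceptional closedL abel twist na.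
  by split=> //; exists sigma, a.
rewrite !(notin_pchar iota) // => h2 h3 /(jinv_1728 iota E h2 h3) c60.
move=> [sigma0 [b nb]].
have [u bE] := exceptional_twist closedL h2 h3 c60 nb.
exact (neg_incl_not_injective abel bE nb).
Qed.
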